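(* Let $j$ be a Lawvere-Tierney topology on an elementary topos $\mathcal X$, let $\mathbb T$ be the double-dualization $\mathcal X$-monad on $\underline{\mathcal X}$ for $\Omega_j$, and let $(\mathcal E,\mathcal M)$ be the epi-mono factorization system on $\mathcal X$. Then: (1) A morphism is $\mathbb T$-dense if and only if it is $j$-dense. (2) A monomorphism is $\mathbb T$-closed if and only if it is $j$-closed. (3) Every morphism in $\mathcal X$ factors as a $\mathbb T$-dense morphism followed by a $\mathbb T$-closed monomorphism. (4) The $\mathbb T$-closure of a subobject is the same as its $j$-closure. (5) An object of $\mathcal X$ is $\mathbb T$-complete if and only if it is a $j$-sheaf. (6) An object of $\mathcal X$ is $\mathbb T$-separated if and only if it is $j$-separated. (7) The idempotent $\mathcal X$-core $\widetilde{\mathbb T}$ of $\mathbb T$ exists, and its associated $\mathcal X$-reflective-subcategory of $\underline{\mathcal X}$ consists of the $j$-sheaves.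
   Context: $\mathcal X$ is regarded as a cartesian closed category, and $\underline{\mathcal X}$ is $\mathcal X$ viewed as an $\mathcal X$-enriched category, with internal homs $\underline{\mathcal X}(X,Y)$. $\Omega$ is the subobject classifier, $j:\Omega\to\Omega$, and $\Omega_j$ is the associated retract of $\Omega$ (the equalizer of $j$ and $1_\Omega$, i.e. the image of the idempotent $j$), which classifies $j$-closed subobjects. The double-dualization $\mathcal X$-monad $\mathbb T=(T,\eta,\mu)$ for $\Omega_j$ is the one induced by the $\mathcal X$-adjunction $\underline{\mathcal X}(-,\Omega_j)\dashv\underline{\mathcal X}(-,\Omega_j):\underline{\mathcal X}^{\mathrm{op}}\to\underline{\mathcal X}$; thus $TX=\underline{\mathcal X}(\underline{\mathcal X}(X,\Omega_j),\Omega_j)$. $j$-notions: the $j$-closure $\overline m$ of a monomorphism $m:M\rightarrowtail X$ with classifying map $\chi_m$ is the subobject of $X$ classified by $j\cdot\chi_m$. $m$ is $j$-closed if $\overline m\cong m$ as subobjects. A morphism $f:X\to Y$ is $j$-dense if the $j$-closure of its image is all of $Y$. An object $Y$ is $j$-separated (resp. a $j$-sheaf) if for every $j$-dense monomorphism $d:D\rightarrowtail X$ the map $\mathcal X(d,Y):\mathcal X(X,Y)\to\mathcal X(D,Y)$ is injective (resp. bijective). $\mathbb T$-notions (with $\mathcal V=\mathcal X$, $\mathcal B=\underline{\mathcal X}$): for $e:A_1\to A_2$ and $m:B_1\to B_2$ in $\mathcal B$, $e\downarrow_{\mathcal V}m$ means that the commutative square with sides $\mathcal B(A_2,m),\mathcal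 B(e,B_1),\mathcal B(e,B_2),\mathcal B(A_1,m)$ exhibits $\mathcal B(A_2,B_1)$ as the pullback of $\mathcal B(A_1,B_1)\to\mathcal B(A_1,B_2)\leftarrow\mathcal B(A_2,B_2)$ in $\mathcal V$. For a class $\mathcal H$ of morphisms, $\mathcal H^{\downarrow_{\mathcal V}}=\{m\mid\forall e\in\mathcal H:e\downarrow_{\mathcal V}m\}$ and $\mathcal H^{\uparrow_{\mathcal V}}=\{e\mid\forall m\in\mathcal H:e\downarrow_{\mathcal V}m\}$. $\Sigma_T$ is the class of morphisms sent by $T$ to isomorphisms. A monomorphism (element of $\mathcal M$) is $\mathbb T$-closed if it lies in $\Sigma_T^{\downarrow_{\mathcal V}}$. A morphism is $\mathbb T$-dense if it lies in $(\Sigma_T^{\downarrow_{\mathcal V}}\cap\mathcal M)^{\uparrow_{\mathcal V}}$. The $\mathbb T$-closure of a monomorphism $m$ is the second factor of the (essentially unique) factorization of $m$ as a $\mathbb T$-dense morphism followed by a $\mathbb T$-closed monomorphism. An object $B$ is $\mathbb T$-complete if $\mathcal B(h,B)$ is an isomorphism in $\mathcal V$ for every $h\in\Sigma_T$, and $\mathbb T$-separated if $\eta_B:B\to TB$ is a monomorphism. An idempotent $\mathcal X$-core of $\mathbb T$ is an idempotent $\mathcal X$-monad (one with invertible multiplication) on $\underline{\mathcal X}$ whose underlying endofunctor inverts (sends to isomorphisms) the same morphisms as $T$; it is unique up to isomorphism if it exists. The $\mathcal X$-reflective-subcategory (full replete sub-$\mathcal X$-category whose inclusion has a left $\mathcal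 X$-adjoint) associated to an idempotent $\mathcal X$-monad with unit $\rho$ consists of the objects $B$ with $\rho_B$ an isomorphism. *)

(* Defs.v *)
From Stdlib Require Import ClassicalEpsilon.

Set Implicit Arguments.
Unset Strict Implicit.
Unset Printing Implicit Defensive.

Record Category := {
  Ob :> Type;
  Hom : Ob -> Ob -> Type;
  idm : forall A, Hom A A;
  comp : forall A B C, Hom B C -> Hom A B -> Hom A C;
  comp_assoc : forall A B C D (h : Hom C D) (g : Hom B C) (f : Hom A B),
    comp (comp h g) f = comp h (comp g f);
  comp_idl : forall A B (f : Hom A B), comp (idm B) f = f;
  comp_idr : forall A B (f : Hom A B), comp f (idm A) = f
}.
Arguments Hom {_} _ _.
Arguments idm {_} A.
Arguments comp {_ A B C} _ _.

Declare Scope cat_scope.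
Open Scope cat_scope.
Notation "g ∘ f" := (comp g f) (at level 40, left associativity) : cat_scope.

Section Morphisms.
Context {X : Category}.

Definition is_iso {A B : X} (f : Hom A B) : Prop :=
  exists g : Hom B A, g ∘ f = idm A /\ f ∘ g = idm B.

Definition is_mono {A B : X} (m : Hom A B) : Prop :=
  forall W (u v : Hom W A), m ∘ u = m ∘ v -> u = v.

Definition is_epi {A B : X} (e : Hom A B) : Prop :=
  forall W (u v : Hom B W), u ∘ e = v ∘ e -> u = v.

(** [P] with projections [p], [q] is a pullback of [f] and [g]. *)
Definition is_pullback {P A B C : X}
    (p : Hom P A) (q : Hom P B) (f : Hom A C) (g : Hom B C) : Prop :=
  f ∘ p = g ∘ q /\
  forall W (a : Hom W A) (b : Hom W B), f ∘ a = g ∘ b ->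
    exists! u : Hom W P, p ∘ u = a /\ q ∘ u = b.

Definition MorClass := forall A B : X, Hom A B -> Prop.

End Morphisms.
Arguments MorClass : clear implicits.

Record CCC := {
  base :> Category;
  one : base;
  bang : forall A : base, Hom A one;
  bang_uniq : forall (A : base) (f : Hom A one), f = bang A;
  bprod : base -> base -> base;
  pi1 : forall A B, Hom (bprod A B) A;
  pi2 : forall A B, Hom (bprod A B) B;
  pairm : forall W A B, Hom W A -> Hom W B -> Hom W (bprod A B);
  pi1_pair : forall W A B (f : Hom W A) (g : Hom W B), pi1 A B ∘ pairm f g = f;
  pi2_pair : forall W A B (f : Hom W A) (g : Hom W B), pi2 A B ∘ pairm f g = g;
  pair_uniq : forall W A B (h : Hom W (bprod A B)),
    pairm (pi1 A B ∘ h) (pi2 A B ∘ h) = h;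
  exp : base -> base -> base;
  ev : forall A B, Hom (bprod (exp A B) A) B;
  curry : forall W A B, Hom (bprod W A) B -> Hom W (exp A B);
  ev_curry : forall W A B (f : Hom (bprod W A) B),
    ev A B ∘ pairm (curry f ∘ pi1 W A) (pi2 W A) = f;
  curry_uniq : forall W A B (h : Hom W (exp A B)),
    curry (ev A B ∘ pairm (h ∘ pi1 W A) (pi2 W A)) = h
}.
Arguments one {_}.
Arguments bang {_} A.
Arguments bprod {_} _ _.
Arguments pi1 {_ A B}.
Arguments pi2 {_ A B}.
Arguments pairm {_ W A B} _ _.
(* [exp A B] is the internal hom "B to the power A". *)
Arguments exp {_} A B.
Arguments ev {_ A B}.
Arguments curry {_ W A B} _.

Notation "⟨ f , g ⟩" := (pairm f g) (at level 0, f at level 99, g at level 99) : cat_scope.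

Section CCCTheory.
Context {V : CCC}.

Lemma hom_one_eq (A : V) (f g : Hom A one) : f = g.
Proof. now rewrite (bang_uniq f), (bang_uniq g). Qed.

Lemma bang_comp (A B : V) (f : Hom A B) : bang B ∘ f = bang A.
Proof. apply hom_one_eq. Qed.

Lemma comp_bang1 (B : V) (f : Hom one B) : f ∘ bang one = f.
Proof. rewrite (hom_one_eq (bang one) (idm one)). apply comp_idr. Qed.

Lemma pair_comp (W' W A B : V) (f : Hom W A) (g : Hom W B) (k : Hom W' W) :
  ⟨f, g⟩ ∘ k = ⟨f ∘ k, g ∘ k⟩.
Proof.
  rewrite <- (pair_uniq (⟨f, g⟩ ∘ k)), <- !comp_assoc.
  now rewrite pi1_pair, pi2_pair.
Qed.

Lemma pair_id (A B : V) : ⟨pi1, pi2⟩ = idm (bprod A B).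
Proof. rewrite <- (pair_uniq (idm (bprod A B))). now rewrite !comp_idr. Qed.

Lemma pair_ext (W A B : V) (f g : Hom W (bprod A B)) :
  pi1 ∘ f = pi1 ∘ g -> pi2 ∘ f = pi2 ∘ g -> f = g.
Proof. intros H K. now rewrite <- (pair_uniq f), <- (pair_uniq g), H, K. Qed.

Lemma ev_curry_pair (W A B : V) (f : Hom (bprod W A) B) (b : Hom W A) :
  ev ∘ ⟨curry f, b⟩ = f ∘ ⟨idm W, b⟩.
Proof.
  transitivity (ev ∘ ⟨curry f ∘ pi1, pi2⟩ ∘ ⟨idm W, b⟩).
  - now rewrite comp_assoc, pair_comp, comp_assoc, pi1_pair, pi2_pair, comp_idr.
  - now rewrite ev_curry.
Qed.

Lemma curry_comp (W' W A B : V) (f : Hom (bprod W A) B) (k : Hom W' W) :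
  curry f ∘ k = curry (f ∘ ⟨k ∘ pi1, pi2⟩).
Proof.
  rewrite <- (curry_uniq (curry f ∘ k)). f_equal.
  transitivity (ev ∘ ⟨curry f ∘ pi1, pi2⟩ ∘ ⟨k ∘ @pi1 V W' A, pi2⟩).
  - now rewrite !comp_assoc, pair_comp, comp_assoc, pi1_pair, pi2_pair.
  - now rewrite ev_curry.
Qed.

Lemma curry_ext (W A B : V) (f g : Hom W (exp A B)) :
  ev ∘ ⟨f ∘ pi1, pi2⟩ = ev ∘ ⟨g ∘ pi1, pi2⟩ -> f = g.
Proof. intros H. now rewrite <- (curry_uniq f), <- (curry_uniq g), H. Qed.

End CCCTheory.

#[global] Hint Rewrite comp_assoc comp_idl comp_idr : ccc.
#[global] Hint Rewrite @pi1_pair @pi2_pair @pair_comp @ev_curry_pair @curry_comp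
  @bang_comp @comp_bang1 @pair_id : ccc.
Ltac ccc := autorewrite with ccc.

Section Names.
Context {V : CCC}.

(** The bijection between global elements of [exp A B] and morphisms. *)
Definition name {A B : V} (f : Hom A B) : Hom one (exp A B) := curry (f ∘ pi2).
Definition unname {A B : V} (t : Hom one (exp A B)) : Hom A B :=
  ev ∘ ⟨t ∘ bang A, idm A⟩.

Lemma unname_name (A B : V) (f : Hom A B) : unname (name f) = f.
Proof.
  unfold unname, name.
  now ccc.
Qed.

Lemma name_unname (A B : V) (t : Hom one (exp A B)) : name (unname t) = t.
Proof.
  unfold unname, name. rewrite <- (curry_uniq t) at 2. f_equal.
  rewrite !comp_assoc, pair_comp, !comp_assoc, comp_idl, bang_comp.
  now rewrite (hom_one_eq pi1 (bang _)).
Qed.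

(** [post A m] is B(A,m) and [pre e B] is B(e,B) for the internal hom. *)
Definition post (A : V) {B1 B2 : V} (m : Hom B1 B2) : Hom (exp A B1) (exp A B2) :=
  curry (m ∘ ev).
Definition pre {A1 A2 : V} (e : Hom A1 A2) (B : V) : Hom (exp A2 B) (exp A1 B) :=
  curry (ev ∘ ⟨pi1, e ∘ pi2⟩).

End Names.

(** The axioms are the usual diagrams, with the associativity and unit
    isomorphisms of the cartesian monoidal structure written with projections. *)
Record XCat (V : CCC) := {
  XOb :> Type;
  XHom : XOb -> XOb -> V;
  xid : forall A, Hom one (XHom A A);
  xcomp : forall A B C, Hom (bprod (XHom B C) (XHom A B)) (XHom A C);
  xcomp_assoc : forall A B C D,
    xcomp A B D ∘ ⟨xcomp B C D ∘ pi1, pi2⟩ =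
    xcomp A C D ∘ ⟨pi1 ∘ pi1, xcomp A B C ∘ ⟨pi2 ∘ pi1, pi2⟩⟩
      :> Hom (bprod (bprod (XHom C D) (XHom B C)) (XHom A B)) (XHom A D);
  xcomp_idl : forall A B,
    xcomp A B B ∘ ⟨xid B ∘ bang _, idm _⟩ = idm (XHom A B);
  xcomp_idr : forall A B,
    xcomp A A B ∘ ⟨idm _, xid A ∘ bang _⟩ = idm (XHom A B)
}.
Arguments XHom {V _} _ _.
Arguments xid {V _} A.
Arguments xcomp {V _ A B C}.

Definition gcomp {V : CCC} {C : XCat V} {A1 A2 A3 : C} {W : V}
    (g : Hom W (XHom A2 A3)) (f : Hom W (XHom A1 A2)) : Hom W (XHom A1 A3) :=
  xcomp ∘ ⟨g, f⟩.
Notation "g ⊚ f" := (gcomp g f) (at level 40, left associativity) : cat_scope.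

Section XCatTheory.
Context {V : CCC} {C : XCat V}.

Lemma gcomp_comp (A1 A2 A3 : C) (W' W : V) (g : Hom W (XHom A2 A3))
    (f : Hom W (XHom A1 A2)) (k : Hom W' W) : (g ⊚ f) ∘ k = (g ∘ k) ⊚ (f ∘ k).
Proof. unfold gcomp. now rewrite comp_assoc, pair_comp. Qed.

Lemma gcomp_assoc (A1 A2 A3 A4 : C) (W : V) (h : Hom W (XHom A3 A4))
    (g : Hom W (XHom A2 A3)) (f : Hom W (XHom A1 A2)) :
  (h ⊚ g) ⊚ f = h ⊚ (g ⊚ f).
Proof.
  pose proof (f_equal (fun k => k ∘ ⟨⟨h, g⟩, f⟩) (xcomp_assoc A1 A2 A3 A4)) as H.
  cbv beta in H; autorewrite with ccc in H. exact H.
Qed.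

Lemma gcomp_idl (A B : C) (W : V) (f : Hom W (XHom A B)) :
  (xid B ∘ bang W) ⊚ f = f.
Proof.
  pose proof (f_equal (fun k => k ∘ f) (xcomp_idl A B)) as H.
  cbv beta in H; autorewrite with ccc in H. exact H.
Qed.

Lemma gcomp_idr (A B : C) (W : V) (f : Hom W (XHom A B)) :
  f ⊚ (xid A ∘ bang W) = f.
Proof.
  pose proof (f_equal (fun k => k ∘ f) (xcomp_idr A B)) as H.
  cbv beta in H; autorewrite with ccc in H. exact H.
Qed.

Lemma gcomp_idl1 (A B : C) (f : Hom one (XHom A B)) : xid B ⊚ f = f.
Proof. rewrite <- (comp_bang1 (xid B)). apply gcomp_idl. Qed.

Lemma gcomp_idr1 (A B : C) (f : Hom one (XHom A B)) : f ⊚ xid A = f.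
Proof. rewrite <- (comp_bang1 (xid A)). apply gcomp_idr. Qed.

End XCatTheory.

(** The underlying ordinary category: morphisms are global elements. *)
Definition Und {V : CCC} (C : XCat V) : Category := {|
  Ob := C;
  Hom A B := Hom (one : V) (XHom A B);
  idm A := xid A;
  comp A1 A2 A3 g f := g ⊚ f;
  comp_assoc := fun A1 A2 A3 A4 h g f => gcomp_assoc h g f;
  comp_idl := fun A B f => gcomp_idl1 f;
  comp_idr := fun A B f => gcomp_idr1 f
|}.

Definition opX {V : CCC} (C : XCat V) : XCat V.
Proof.
  refine {|
    XOb := C;
    XHom A B := @XHom V C B A;
    xid A := xid A;
    xcomp A1 A2 A3 := @xcomp V C A3 A2 A1 ∘ ⟨pi2, pi1⟩
  |}.
  - intros A1 A2 A3 A4. ccc. symmetry. apply gcomp_assoc.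
  - intros A B. ccc. apply gcomp_idr.
  - intros A B. ccc. apply gcomp_idl.
Defined.

Definition self (V : CCC) : XCat V.
Proof.
  refine {|
    XOb := V;
    XHom A B := exp A B;
    xid A := name (idm A);
    xcomp A1 A2 A3 := curry (ev ∘ ⟨pi1 ∘ pi1, ev ∘ ⟨pi2 ∘ pi1, pi2⟩⟩)
  |}; unfold name; intros; ccc.
  - reflexivity.
  - apply curry_ext. now ccc.
  - apply curry_ext. now ccc.
Defined.

Record XFun {V : CCC} (C D : XCat V) := {
  fob :> C -> D;
  fhom : forall A B : C, Hom (XHom A B) (XHom (fob A) (fob B));
  fhom_comp : forall A1 A2 A3 : C,
    fhom A1 A3 ∘ xcomp = xcomp ∘ ⟨fhom A2 A3 ∘ pi1, fhom A1 A2 ∘ pi2⟩;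
  fhom_id : forall A : C, fhom A A ∘ xid A = xid (fob A)
}.
Arguments fhom {V C D} _ {A B}.

Section XFunTheory.
Context {V : CCC} {C D : XCat V} (F : XFun C D).

Lemma fhom_gcomp (A1 A2 A3 : C) (W : V) (g : Hom W (XHom A2 A3))
    (f : Hom W (XHom A1 A2)) :
  fhom F ∘ (g ⊚ f) = (fhom F ∘ g) ⊚ (fhom F ∘ f).
Proof.
  unfold gcomp. rewrite <- comp_assoc, fhom_comp. now ccc.
Qed.

Lemma fhom_xid (A : C) (W : V) (k : Hom W one) :
  fhom F ∘ (xid A ∘ k) = xid (F A) ∘ k.
Proof. now rewrite <- comp_assoc, fhom_id. Qed.

End XFunTheory.

Definition idX {V : CCC} (C : XCat V) : XFun C C.
Proof.
  refine {| fob A := A; fhom A B := idm (XHom A B) |}; intros; now ccc.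
Defined.

Definition compX {V : CCC} {C D E : XCat V} (G : XFun D E) (F : XFun C D) : XFun C E.
Proof.
  refine {| fob A := G (F A); fhom A B := @fhom _ _ _ G (F A) (F B) ∘ fhom F |}.
  - intros. rewrite !comp_assoc, fhom_comp, <- !comp_assoc, fhom_comp. now ccc.
  - intros. now rewrite comp_assoc, !fhom_id.
Defined.

Record XNat {V : CCC} {C D : XCat V} (F G : XFun C D) := {
  ncomp :> forall A : C, Hom one (XHom (F A) (G A));
  ncomp_nat : forall A B : C,
    xcomp ∘ ⟨ncomp B ∘ bang _, fhom F⟩ =
    xcomp ∘ ⟨fhom G, ncomp A ∘ bang _⟩ :> Hom (XHom A B) (XHom (F A) (G B))
}.

Lemma ncomp_gnat {V : CCC} {C D : XCat V} (F G : XFun C D) (a : XNat F G)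
    (A B : C) (W : V) (f : Hom W (XHom A B)) :
  (a B ∘ bang W) ⊚ (fhom F ∘ f) = (fhom G ∘ f) ⊚ (a A ∘ bang W).
Proof.
  pose proof (f_equal (fun k => k ∘ f) (ncomp_nat a A B)) as H.
  cbv beta in H. rewrite !comp_assoc, !pair_comp, !comp_assoc, !bang_comp in H. exact H.
Qed.

Lemma ncomp_nat1 {V : CCC} {C D : XCat V} (F G : XFun C D) (a : XNat F G)
    (A B : C) (f : Hom one (XHom A B)) :
  a B ⊚ (fhom F ∘ f) = (fhom G ∘ f) ⊚ a A.
Proof.
  pose proof (ncomp_gnat a f) as H. rewrite !comp_bang1 in H. exact H.
Qed.

(** [F] is left X-adjoint to [G], presented by unit and counit. *)
Record XAdj {V : CCC} {C D : XCat V} (F : XFun C D) (G : XFun D C) := {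
  adj_unit : XNat (idX C) (compX G F);
  adj_counit : XNat (compX F G) (idX D);
  triangleF : forall A : C,
    adj_counit (F A) ⊚ (fhom F ∘ adj_unit A) = xid (F A);
  triangleG : forall B : D,
    (fhom G ∘ adj_counit B) ⊚ adj_unit (G B) = xid (G B)
}.

Record XMonad {V : CCC} (C : XCat V) := {
  mfun :> XFun C C;
  eta : XNat (idX C) mfun;
  mu : XNat (compX mfun mfun) mfun;
  mu_eta_l : forall A : C, mu A ⊚ (fhom mfun ∘ eta A) = xid (mfun A);
  mu_eta_r : forall A : C, mu A ⊚ eta (mfun A) = xid (mfun A);
  mu_mu : forall A : C, mu A ⊚ (fhom mfun ∘ mu A) = mu A ⊚ mu (mfun A)
}.

Definition mu_of_adj {V : CCC} {C D : XCat V} (F : XFun C D) (G : XFun D C)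
    (H : XAdj F G) : XNat (compX (compX G F) (compX G F)) (compX G F).
Proof.
  refine {| ncomp := fun A => fhom G ∘ adj_counit H (F A)
    : Hom one (XHom (compX (compX G F) (compX G F) A) (compX G F A)) |}.
  intros A B. cbn [fob fhom compX].
  pose proof (ncomp_gnat (adj_counit H) (@fhom _ _ _ F A B)) as N.
  apply (f_equal (fun k => fhom G ∘ k)) in N.
  rewrite !fhom_gcomp in N. unfold gcomp in N. cbn [fob fhom compX idX] in N.
  rewrite comp_idl in N. rewrite !comp_assoc in *. exact N.
Defined.

Definition monad_of_adj {V : CCC} {C D : XCat V} (F : XFun C D) (G : XFun D C)
    (H : XAdj F G) : XMonad C.
Proof.
  refine {| mfun := compX G F; eta := adj_unit H; mu := mu_of_adj H |}.
  - intros A. cbn [fob fhom compX ncomp mu_of_adj]. rewrite comp_assoc, <- fhom_gcomp.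
    rewrite (triangleF H). apply fhom_id.
  - intros A. cbn [fob fhom compX ncomp mu_of_adj]. apply (triangleG H).
  - intros A. cbn [fob fhom compX ncomp mu_of_adj]. rewrite comp_assoc, <- !fhom_gcomp.
    f_equal.
    pose proof (ncomp_nat1 (adj_counit H) (adj_counit H (F A))) as N.
    cbn [fob fhom compX idX] in N. rewrite comp_idl, comp_assoc in N.
    symmetry in N. symmetry. exact N.
Defined.

Definition idempotent {V : CCC} {C : XCat V} (S : XMonad C) : Prop :=
  forall A : C, @is_iso (Und C) _ _ (mu S A).

Definition fullsub {V : CCC} (C : XCat V) (P : C -> Prop) : XCat V.
Proof.
  refine {|
    XOb := {A : C | P A};
    XHom A B := @XHom V C (proj1_sig A) (proj1_sig B);
    xid A := xid (proj1_sig A);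
    xcomp A1 A2 A3 := @xcomp V C (proj1_sig A1) (proj1_sig A2) (proj1_sig A3)
  |}; intros.
  - apply xcomp_assoc.
  - apply xcomp_idl.
  - apply xcomp_idr.
Defined.

Definition inclX {V : CCC} {C : XCat V} (P : C -> Prop) : XFun (fullsub P) C.
Proof.
  refine {|
    fob (A : fullsub P) := proj1_sig A : C;
    fhom A B := idm (@XHom V C (proj1_sig A) (proj1_sig B))
  |}; intros; cbn; now ccc.
Defined.

Record XReflective {V : CCC} (C : XCat V) := {
  robj : C -> Prop;
  robj_replete : forall (A B : C) (f : @Hom (Und C) A B), is_iso f -> robj A -> robj B;
  reflector : XFun C (fullsub robj);
  reflection : XAdj reflector (inclX robj)
}.

Section Associated.
Context {V : CCC} {C : XCat V} (S : XMonad C) (HS : idempotent S).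

Definition fixed (B : C) : Prop := @is_iso (Und C) B (S B) (eta S B).

Lemma eta_gnat (A B : C) (W : V) (f : Hom W (XHom A B)) :
  @gcomp V C A B (S B) W (eta S B ∘ bang W) f =
  @gcomp V C A (S A) (S B) W (fhom S ∘ f) (eta S A ∘ bang W).
Proof.
  pose proof (ncomp_gnat (eta S) f) as N. cbn in N. rewrite comp_idl in N. exact N.
Qed.

Lemma eta_nat1 (A B : C) (f : Hom one (XHom A B)) :
  @gcomp V C A B (S B) one (eta S B) f =
  @gcomp V C A (S A) (S B) one (fhom S ∘ f) (eta S A).
Proof. pose proof (eta_gnat f) as N. rewrite !comp_bang1 in N. exact N. Qed.

Lemma fixed_replete (A B : C) (f : @Hom (Und C) A B) :
  is_iso f -> fixed A -> fixed B.
Proof.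
  intros [g [gf fg]] [r [r1 r2]]. cbn in *.
  exists (f ⊚ (r ⊚ (fhom S ∘ g))). cbn. split.
  - rewrite !gcomp_assoc.
    rewrite <- eta_nat1, <- (gcomp_assoc r), r1, gcomp_idl1. exact fg.
  - rewrite <- gcomp_assoc, eta_nat1, gcomp_assoc, <- (gcomp_assoc _ r), r2.
    rewrite gcomp_idl1, <- fhom_gcomp, fg. apply fhom_id.
Qed.

Let n (A : C) : Hom one (XHom A (S A)) := eta S A.
Let m (A : C) : Hom one (XHom (S (S A)) (S A)) := mu S A.

Lemma eta_free (A : C) : n (S A) = fhom S ∘ n A.
Proof.
  pose proof (mu_eta_l S A : m A ⊚ (fhom S ∘ n A) = xid (S A)) as L.
  pose proof (mu_eta_r S A : m A ⊚ n (S A) = xid (S A)) as R.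
  destruct (HS A : exists g, g ⊚ m A = xid (S (S A)) /\ m A ⊚ g = xid (S A))
    as [g [gm _]].
  rewrite <- (gcomp_idl1 (n (S A))), <- (gcomp_idl1 (fhom S ∘ n A)), <- gm.
  rewrite !gcomp_assoc. f_equal. now rewrite L, R.
Qed.

Lemma fixed_free (A : C) : fixed (S A).
Proof.
  pose proof (mu_eta_r S A : m A ⊚ n (S A) = xid (S A)) as R.
  destruct (HS A : exists g, g ⊚ m A = xid (S (S A)) /\ m A ⊚ g = xid (S A))
    as [g [gm _]].
  exists (m A : Hom one (XHom (S (S A)) (S A))). split; [exact R|].
  change (n (S A) ⊚ m A = xid (S (S A))).
  assert (E : g = n (S A)).
  { rewrite <- (gcomp_idr1 g), <- R, <- gcomp_assoc, gm. apply gcomp_idl1. }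
  rewrite <- E. exact gm.
Qed.

Definition inv_eta (B : C) (H : fixed B) : Hom one (XHom (S B) B) :=
  proj1_sig (constructive_indefinite_description _ H).

Lemma inv_eta_l (B : C) (H : fixed B) : inv_eta H ⊚ eta S B = xid B.
Proof. exact (proj1 (proj2_sig (constructive_indefinite_description _ H))). Qed.

Lemma inv_eta_r (B : C) (H : fixed B) : eta S B ⊚ inv_eta H = xid (S B).
Proof. exact (proj2 (proj2_sig (constructive_indefinite_description _ H))). Qed.

Lemma eta_cancel (B D : C) (W : V) (H : fixed D) (u v : Hom W (XHom B D)) :
  (eta S D ∘ bang W) ⊚ u = (eta S D ∘ bang W) ⊚ v -> u = v.
Proof.
  intros E. apply (f_equal (fun k => (inv_eta H ∘ bang W) ⊚ k)) in E.
  rewrite <- !gcomp_assoc, <- !gcomp_comp, inv_eta_l, !gcomp_idl in E. exact E.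
Qed.

Definition corestrict : XFun C (fullsub fixed).
Proof.
  refine {|
    fob A := exist fixed (S A) (fixed_free A) : fullsub fixed;
    fhom A B := @fhom V C C S A B
  |}.
  - intros. apply fhom_comp.
  - intros. apply fhom_id.
Defined.

Definition corestrict_adj : XAdj corestrict (inclX fixed).
Proof.
  unshelve refine {|
    adj_unit := {| ncomp := fun A => eta S A
      : Hom one (XHom (idX C A) (compX (inclX fixed) corestrict A)) |};
    adj_counit := {| ncomp := fun B : fullsub fixed => inv_eta (proj2_sig B)
      : Hom one (XHom (compX corestrict (inclX fixed) B) (idX (fullsub fixed) B)) |}
  |}.
  - intros A B. pose proof (ncomp_nat (eta S) A B) as N. cbn in *.
    rewrite comp_idl. exact N.
  - intros [A HA] [B HB]. cbn. rewrite comp_idr.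
    change (@gcomp V C (S A) (S B) B _ (inv_eta HB ∘ bang _) (fhom S)
      = @gcomp V C (S A) A B _ (idm _) (inv_eta HA ∘ bang _)).
    apply (eta_cancel HB).
    rewrite <- !gcomp_assoc, <- gcomp_comp, inv_eta_r, gcomp_idl.
    rewrite eta_gnat, comp_idr, gcomp_assoc, <- gcomp_comp, inv_eta_r, gcomp_idr.
    reflexivity.
  - intros A. cbn.
    change (@gcomp V C (S A) (S (S A)) (S A) one (inv_eta (fixed_free A)) (fhom S ∘ n A)
      = xid (S A)).
    rewrite <- eta_free. apply inv_eta_l.
  - intros [B HB]. cbn. rewrite comp_idl. apply inv_eta_l.
Defined.

Definition reflective_of_idempotent : XReflective C :=
  {| robj := fixed; robj_replete := fixed_replete; reflection := corestrict_adj |}.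

End Associated.

(** C(-,W) as an enriched functor from the opposite of [C]. *)
Definition repX {V : CCC} (C : XCat V) (W : C) : XFun (opX C) (self V).
Proof.
  refine {|
    fob (A : opX C) := @XHom V C A W : self V;
    fhom (A B : opX C) := curry (@xcomp V C B A W ∘ ⟨pi2, pi1⟩)
      : Hom (@XHom V (opX C) A B) (@XHom V (self V) (@XHom V C A W) (@XHom V C B W))
  |}.
  - intros A1 A2 A3. cbn. apply curry_ext. ccc.
    symmetry. apply gcomp_assoc.
  - intros A. cbn. apply curry_ext. unfold name. ccc.
    rewrite (hom_one_eq pi1 (bang _)). apply gcomp_idr.
Defined.

(** A functor out of the opposite of [C], read as a functor into the opposite of [D]. *)
Definition opfunX {V : CCC} {C D : XCat V} (F : XFun (opX C) D) : XFun C (opX D).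
Proof.
  refine {|
    fob (A : C) := F A : opX D;
    fhom (A B : C) := @fhom V (opX C) D F B A
  |}.
  - intros A1 A2 A3. cbn.
    pose proof (@fhom_comp V (opX C) D F A3 A2 A1) as N. cbn in N.
    apply (f_equal (fun k => k ∘ ⟨pi2, pi1⟩)) in N.
    rewrite !comp_assoc, !pair_comp, !comp_assoc in N.
    rewrite !pi1_pair, !pi2_pair, pair_id, comp_idr in N.
    rewrite N. now ccc.
  - intros A. exact (@fhom_id V (opX C) D F A).
Defined.

Section DoubleDual.
Context {V : CCC} (W : V).

Definition dual : XFun (opX (self V)) (self V) := repX (W : self V).
Definition dual_op : XFun (self V) (opX (self V)) := opfunX dual.

(** Evaluation: a ↦ (φ ↦ φ a). *)
Definition dual_ev (A : V) : Hom A (exp (exp A W) W) := curry (ev ∘ ⟨pi2, pi1⟩).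

Definition dual_unit : XNat (idX (self V)) (compX dual dual_op).
Proof.
  refine {| ncomp := fun A : self V => name (dual_ev A)
    : Hom one (XHom (idX (self V) A) (compX dual dual_op A)) |}.
  intros A B. unfold name, dual_ev. cbn. ccc. apply curry_ext. ccc.
  apply curry_ext. ccc. reflexivity.
Defined.

Definition dual_counit : XNat (compX dual_op dual) (idX (opX (self V))).
Proof.
  refine {| ncomp := fun A : opX (self V) => name (dual_ev A)
    : Hom one (@XHom V (opX (self V)) (compX dual_op dual A) (idX (opX (self V)) A)) |}.
  intros A B. unfold name, dual_ev. cbn. ccc. apply curry_ext. ccc.
  apply curry_ext. ccc. reflexivity.
Defined.

Definition dual_adj : XAdj dual_op dual.
Proof.
  refine {| adj_unit := dual_unit; adj_counit := dual_counit |}.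
  - intros A. unfold gcomp, name, dual_ev. cbn. ccc. apply curry_ext. ccc.
    unfold name, dual_ev. ccc. apply curry_uniq.
  - intros A. unfold gcomp, name, dual_ev. cbn. ccc. apply curry_ext. ccc.
    unfold name, dual_ev. ccc. apply curry_uniq.
Defined.

Definition double_dual : XMonad (self V) := monad_of_adj dual_adj.

End DoubleDual.

Record Topos := {
  tccc :> CCC;
  equ : forall A B : tccc, Hom A B -> Hom A B -> tccc;
  equ_arr : forall (A B : tccc) (f g : Hom A B), Hom (equ f g) A;
  equ_eq : forall (A B : tccc) (f g : Hom A B), f ∘ equ_arr f g = g ∘ equ_arr f g;
  equ_univ : forall (A B : tccc) (f g : Hom A B) W (h : Hom W A),
    f ∘ h = g ∘ h -> exists! u : Hom W (equ f g), equ_arr f g ∘ u = h;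
  Omega : tccc;
  tru : Hom one Omega;
  chi : forall (U A : tccc) (m : Hom U A), is_mono m -> Hom A Omega;
  chi_pullback : forall (U A : tccc) (m : Hom U A) (Hm : is_mono m),
    is_pullback m (bang U) (chi Hm) tru;
  chi_uniq : forall (U A : tccc) (m : Hom U A) (Hm : is_mono m) (phi : Hom A Omega),
    is_pullback m (bang U) phi tru -> phi = chi Hm
}.
Arguments equ {_ A B} f g.
Arguments equ_arr {_ A B} f g.
Arguments Omega {_}.
Arguments tru {_}.

Record Sub {X : Category} (A : X) := {
  sdom : X;
  sarr : Hom sdom A;
  smono : is_mono sarr
}.
Arguments smono {X A} _ W u v _.

Definition sub_iso {X : Category} {A : X} (m n : Sub A) : Prop :=
  exists u : Hom (sdom m) (sdom n), is_iso u /\ sarr n ∘ u = sarr m.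

Definition is_total {X : Category} {A : X} (m : Sub A) : Prop := is_iso (sarr m).

Section ToposTheory.
Context {X : Topos}.

Lemma equ_mono (A B : X) (f g : Hom A B) : is_mono (equ_arr f g).
Proof.
  intros W u v H.
  destruct (@equ_univ X A B f g W (equ_arr f g ∘ u)) as [w [_ Hw]].
  { now rewrite <- !comp_assoc, equ_eq. }
  now rewrite <- (Hw u eq_refl), <- (Hw v (eq_sym H)).
Qed.

Lemma one_mono (A : X) (f : Hom one A) : is_mono f.
Proof. intros W u v _. apply hom_one_eq. Qed.
Arguments one_mono {A} f W u v _.

Definition sub_chi {A : X} (m : Sub A) : Hom A Omega := chi (smono m).

(** The subobject classified by [phi]: the pullback of [tru] along [phi]. *)
Definition classified {A : X} (phi : Hom A Omega) : Sub A :=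
  {| sarr := equ_arr phi (tru ∘ bang A); smono := @equ_mono _ _ _ _ |}.

Lemma classified_pullback (A : X) (phi : Hom A Omega) :
  is_pullback (sarr (classified phi)) (bang _) phi tru.
Proof.
  split.
  - cbn. now rewrite equ_eq, comp_assoc, bang_comp.
  - intros W a b H. destruct (@equ_univ X A Omega phi (tru ∘ bang A) W a) as [u [Hu Hu']].
    { now rewrite H, comp_assoc, bang_comp, (bang_uniq b). }
    exists u. split.
    + split; [exact Hu | apply hom_one_eq].
    + intros v [Hv _]. now apply Hu'.
Qed.

Lemma chi_classified (A : X) (phi : Hom A Omega) : sub_chi (classified phi) = phi.
Proof. symmetry. apply chi_uniq, classified_pullback. Qed.

Definition and_omega : Hom (bprod Omega Omega) (Omega : X) := chi (one_mono ⟨tru, tru⟩).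

End ToposTheory.

Record LawvereTierney (X : Topos) := {
  jmap :> Hom (Omega : X) Omega;
  j_tru : jmap ∘ tru = tru;
  j_idem : jmap ∘ jmap = jmap;
  j_and : jmap ∘ and_omega = and_omega ∘ ⟨jmap ∘ pi1, jmap ∘ pi2⟩
}.

Section JNotions.
Context {X : Topos} (j : LawvereTierney X).

Definition Omega_j : X := equ j (idm Omega).

Definition j_closure {A : X} (m : Sub A) : Sub A := classified (j ∘ sub_chi m).

Definition j_closed {A : X} (m : Sub A) : Prop := sub_iso (j_closure m) m.

(** [m] is the image of [f], computed by an epi-mono factorization. *)
Definition j_dense {A B : X} (f : Hom A B) : Prop :=
  exists (m : Sub B) (e : Hom A (sdom m)),
    is_epi e /\ f = sarr m ∘ e /\ is_total (j_closure m).

Definition j_separated (Y : X) : Prop :=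
  forall (D A : X) (d : Hom D A), is_mono d -> j_dense d ->
    forall u v : Hom A Y, u ∘ d = v ∘ d -> u = v.

Definition j_sheaf (Y : X) : Prop :=
  forall (D A : X) (d : Hom D A), is_mono d -> j_dense d ->
    forall g : Hom D Y, exists! u : Hom A Y, u ∘ d = g.

End JNotions.

Definition orth {V : CCC} {A1 A2 B1 B2 : V} (e : Hom A1 A2) (m : Hom B1 B2) : Prop :=
  is_pullback (pre e B1) (post A2 m) (post A1 m) (pre e B2).

Definition orth_down {V : CCC} (H : MorClass V) : MorClass V :=
  fun B1 B2 m => forall (A1 A2 : V) (e : Hom A1 A2), H A1 A2 e -> orth e m.
Definition orth_up {V : CCC} (H : MorClass V) : MorClass V :=
  fun A1 A2 e => forall (B1 B2 : V) (m : Hom B1 B2), H B1 B2 m -> orth e m.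

Section TNotions.
Context {V : CCC} (T : XMonad (self V)).

(** The underlying endofunctor and unit, transported along [name]/[unname]. *)
Definition umap {A B : V} (f : Hom A B) : Hom (T A : V) (T B : V) :=
  unname (fhom T ∘ (name f : Hom one (@XHom V (self V) A B))).
Definition ueta (A : V) : Hom A (T A : V) := unname (eta T A).

Definition Sigma : MorClass V := fun A B f => is_iso (umap f).

Definition T_closed : MorClass V := fun A B m => orth_down Sigma m /\ is_mono m.

Definition T_dense : MorClass V := orth_up T_closed.

(** [c] is the second factor of a (dense, closed mono)-factorization of [m]. *)
Definition is_T_closure {A : V} (m c : Sub A) : Prop :=
  exists e : Hom (sdom m) (sdom c),
    sarr m = sarr c ∘ e /\ T_dense e /\ T_closed (sarr c).

Definition T_complete (B : V) : Prop :=
  forall (A1 A2 : V) (h : Hom A1 A2), Sigma h -> is_iso (pre h B).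

Definition T_separated (B : V) : Prop := is_mono (ueta B).

End TNotions.

Record idempotent_core {V : CCC} (T S : XMonad (self V)) : Prop := {
  core_idempotent : idempotent S;
  core_inverts : forall (A B : V) (f : Hom A B), Sigma S f <-> Sigma T f
}.

(* Main.v *)
From Stdlib Require Import ClassicalEpsilon.
Require Import Defs.

Set Implicit Arguments.
Unset Strict Implicit.
Unset Printing Implicit Defensive.

(** Write R for [Omega_j j] and D for the contravariant functor [exp - R], so that
    T = DD with unit the evaluation [dual_ev R]. Everything rests on three facts.

    First, T inverts [h] exactly when D does ([Sigma_double_dual]): if DDh is
    invertible, the triangle identities express an inverse of Dh. So the
    enriched orthogonality notions for T are statements about unique extension of
    R-valued maps along W × h, for all parameter objects W.

    Secondly, R is a sheaf ([closed_eq_of_dense], [Omega_j_extend]): a closed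
    truth value is recovered from its restriction to a dense subobject because
    [j] preserves truth and meets, and one given on the dense subobject extends
    by composing monomorphisms and closing. Hence dense monomorphisms are in
    [Sigma T]. Conversely a closed subobject is the equalizer of two R-valued
    maps, its classifying map and truth, so it is orthogonal to every [e] along
    which R-valued maps are determined; both [Sigma T] and the j-dense morphisms
    have this property ([closed_orth], [j_dense_cancel]). Comparing a subobject
    with its closure then identifies closed, dense and closure on both sides; the
    factorization is the epi-mono factorization followed by closure.

    Thirdly, two generalized elements of [B] have the same image under
    [dual_ev R B] exactly when their equalizer is dense, as one sees by testing on
    the closure of the diagonal; so the unit is monic iff [B] is separated
    ([separated_ev_mono]). If [B] is a sheaf, the unit is moreover closed, because
    the dense inclusion of [B] in its closure has a retraction. A closed subobject
    of the complete object DDB is complete, and so sheaves are complete.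

    For the idempotent core, factor the unit at [A] as a dense [e] followed by a
    closed subobject [c] of TA. The domain of [c] is complete, [De] is monic by
    density of [e], and it is split epic because the triangle identity splits
    D(unit) = De ∘ Dc; so T inverts [e] and [e] is a reflection of [A] into
    complete objects ([reflection_exists]). Such reflections assemble into an
    idempotent enriched monad ([core_exists]), and the fixed objects of any core
    are the complete objects ([core_fixed]), that is, the sheaves. *)

#[local] Hint Rewrite @pair_uniq : ccc.

(** * Isomorphisms *)

Section Isomorphisms.
Context {X : Category}.

Lemma iso_id (A : X) : is_iso (idm A).
Proof. exists (idm A). now rewrite comp_idl. Qed.

Lemma iso_comp (A B C : X) (g : Hom B C) (f : Hom A B) :
  is_iso g -> is_iso f -> is_iso (g ∘ f).
Proof.
  intros [g' [g1 g2]] [f' [f1 f2]]. exists (f' ∘ g'). split.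
  - now rewrite comp_assoc, <- (comp_assoc g'), g1, comp_idl.
  - now rewrite comp_assoc, <- (comp_assoc f), f2, comp_idl.
Qed.

Lemma iso_cancel_l (A B C : X) (g : Hom B C) (f : Hom A B) :
  is_iso g -> is_iso (g ∘ f) -> is_iso f.
Proof.
  intros [g' [g1 g2]] H.
  rewrite <- (comp_idl f), <- g1, comp_assoc. apply iso_comp; [|exact H].
  now exists g.
Qed.

Lemma iso_cancel_r (A B C : X) (g : Hom B C) (f : Hom A B) :
  is_iso f -> is_iso (g ∘ f) -> is_iso g.
Proof.
  intros [f' [f1 f2]] H.
  rewrite <- (comp_idr g), <- f2, <- comp_assoc. apply iso_comp; [exact H|].
  now exists f.
Qed.

Lemma iso_mono (A B : X) (f : Hom A B) : is_iso f -> is_mono f.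
Proof.
  intros [g [g1 _]] W u v E.
  now rewrite <- (comp_idl u), <- (comp_idl v), <- g1, !comp_assoc, E.
Qed.

Lemma iso_epi (A B : X) (f : Hom A B) : is_iso f -> is_epi f.
Proof.
  intros [g [_ g2]] W u v E.
  now rewrite <- (comp_idr u), <- (comp_idr v), <- g2, <- !comp_assoc, E.
Qed.

Lemma mono_retraction_iso (A B : X) (f : Hom A B) (g : Hom B A) :
  is_mono f -> f ∘ g = idm B -> is_iso f.
Proof.
  intros Hf E. exists g. split; [|exact E].
  apply Hf. now rewrite <- comp_assoc, E, comp_idl, comp_idr.
Qed.

Lemma mono_comp (A B C : X) (g : Hom B C) (f : Hom A B) :
  is_mono g -> is_mono f -> is_mono (g ∘ f).
Proof.
  intros Hg Hf W u v E. rewrite !comp_assoc in E. now apply Hf, Hg.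
Qed.

Lemma mono_right_factor (A B C : X) (g : Hom B C) (f : Hom A B) :
  is_mono (g ∘ f) -> is_mono f.
Proof. intros H W u v E. apply H. now rewrite !comp_assoc, E. Qed.

End Isomorphisms.

(** * Internal homs through generalized elements *)

Section InternalHoms.
Context {V : CCC}.

Definition uncurry {W A B : V} (h : Hom W (exp A B)) : Hom (bprod W A) B :=
  ev ∘ ⟨h ∘ pi1, pi2⟩.

(** This is W × e. *)
Definition whisk (W : V) {A B : V} (e : Hom A B) : Hom (bprod W A) (bprod W B) :=
  ⟨pi1, e ∘ pi2⟩.

Lemma uncurry_curry (W A B : V) (f : Hom (bprod W A) B) : uncurry (curry f) = f.
Proof. apply ev_curry. Qed.

Lemma curry_uncurry (W A B : V) (h : Hom W (exp A B)) : curry (uncurry h) = h.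
Proof. apply curry_uniq. Qed.

Lemma curry_inj (W A B : V) (f g : Hom (bprod W A) B) : curry f = curry g -> f = g.
Proof. intros E. now rewrite <- (uncurry_curry f), E, uncurry_curry. Qed.

Lemma pre_curry (A1 A2 B W : V) (e : Hom A1 A2) (g : Hom (bprod W A2) B) :
  pre e B ∘ curry g = curry (g ∘ whisk W e).
Proof. unfold pre, whisk. now ccc. Qed.

Lemma post_curry (A B1 B2 W : V) (m : Hom B1 B2) (g : Hom (bprod W A) B1) :
  post A m ∘ curry g = curry (m ∘ g).
Proof. unfold post. now ccc. Qed.

Lemma pre_comp (A1 A2 A3 B : V) (g : Hom A2 A3) (f : Hom A1 A2) :
  pre (g ∘ f) B = pre f B ∘ pre g B.
Proof. unfold pre. now ccc. Qed.

Lemma pre_id (A B : V) : pre (idm A) B = idm (exp A B).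
Proof.
  unfold pre. apply curry_ext. now ccc.
Qed.

Lemma pre_iso (A1 A2 B : V) (h : Hom A1 A2) : is_iso h -> is_iso (pre h B).
Proof.
  intros [k [k1 k2]]. exists (pre k B).
  now rewrite <- !pre_comp, k1, k2, !pre_id.
Qed.

(** The nontrivial direction is the Yoneda argument: extending the evaluation
    [ev] gives the inverse. *)
Lemma pre_iso_iff (A1 A2 B : V) (h : Hom A1 A2) :
  is_iso (pre h B) <->
  forall (W : V) (g : Hom (bprod W A1) B),
    exists! u : Hom (bprod W A2) B, u ∘ whisk W h = g.
Proof.
  split.
  - intros [k [k1 k2]] W g. exists (uncurry (k ∘ curry g)). split.
    + apply curry_inj. rewrite <- pre_curry, curry_uncurry.
      now rewrite <- comp_assoc, k2, comp_idl.
    + intros u <-. apply curry_inj.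
      now rewrite curry_uncurry, <- pre_curry, <- comp_assoc, k1, comp_idl.
  - intros H. destruct (H _ ev) as [u [Hu _]].
    apply mono_retraction_iso with (curry u).
    + intros W a b E. rewrite <- (curry_uncurry a), <- (curry_uncurry b), !pre_curry in E.
      apply curry_inj in E. destruct (H _ (uncurry b ∘ whisk W h)) as [c [_ Hc]].
      rewrite <- (curry_uncurry a), <- (curry_uncurry b).
      now rewrite <- (Hc _ E), <- (Hc _ eq_refl).
    + rewrite pre_curry, Hu. apply curry_ext. now ccc.
Qed.

(** Sliding the exponent [Z] into the parameter object turns a lifting problem for
    [exp Z B] into one for [B]. *)
Lemma pre_iso_power (A1 A2 B Z : V) (h : Hom A1 A2) :
  is_iso (pre h B) -> is_iso (pre h (exp Z B)).
Proof.
  intros H. apply pre_iso_iff. intros W g.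
  rewrite pre_iso_iff in H.
  destruct (H (bprod W Z) (uncurry g ∘ ⟨⟨pi1 ∘ pi1, pi2⟩, pi2 ∘ pi1⟩)) as [u [Hu Uu]].
  exists (curry (u ∘ ⟨⟨pi1 ∘ pi1, pi2⟩, pi2 ∘ pi1⟩)). split.
  - transitivity (curry (uncurry g)); [|apply curry_uncurry].
    apply (f_equal (fun k => k ∘ ⟨⟨pi1 ∘ pi1, pi2⟩, pi2 ∘ pi1⟩)) in Hu.
    unfold whisk, uncurry in *. autorewrite with ccc in *. now rewrite Hu.
  - intros v Hv. rewrite <- (curry_uncurry v). f_equal.
    rewrite (Uu (uncurry v ∘ ⟨⟨pi1 ∘ pi1, pi2⟩, pi2 ∘ pi1⟩)).
    + now ccc.
    + rewrite <- Hv. unfold whisk, uncurry. now ccc.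
Qed.

(** A generalized element of an internal hom with parameter [W] is a morphism out
    of a product with [W], so the pullback condition on internal homs says that
    every W × e lifts uniquely against [m]. *)
Lemma orth_iff (A1 A2 B1 B2 : V) (e : Hom A1 A2) (m : Hom B1 B2) :
  orth e m <->
  forall (W : V) (a : Hom (bprod W A1) B1) (b : Hom (bprod W A2) B2),
    m ∘ a = b ∘ whisk W e ->
    exists! u : Hom (bprod W A2) B1, u ∘ whisk W e = a /\ m ∘ u = b.
Proof.
  split.
  - intros [_ H] W a b E. destruct (H W (curry a) (curry b)) as [u [[H1 H2] Hu]].
    { now rewrite post_curry, pre_curry, E. }
    rewrite <- (curry_uncurry u), pre_curry in H1.
    rewrite <- (curry_uncurry u), post_curry in H2.
    exists (uncurry u). split.
    + split; now apply curry_inj.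
    + intros v [<- <-]. rewrite <- (uncurry_curry v). f_equal. apply Hu.
      now rewrite pre_curry, post_curry.
  - intros H. split.
    + unfold pre, post. now ccc.
    + intros W a b E.
      rewrite <- (curry_uncurry a), <- (curry_uncurry b), post_curry, pre_curry in E.
      apply curry_inj in E. destruct (H _ _ _ E) as [u [[H1 H2] Hu]].
      exists (curry u). split.
      * now rewrite pre_curry, post_curry, H1, H2, !curry_uncurry.
      * intros v [<- <-]. rewrite <- (curry_uncurry v). f_equal. apply Hu.
        rewrite <- (uncurry_curry (uncurry v ∘ _)), <- pre_curry, curry_uncurry.
        rewrite <- (uncurry_curry (m ∘ _)), <- post_curry, curry_uncurry.
        now split.
Qed.

(** The lift is found at the parameter object [one], where the enriched square of
    homs reduces to the set of commutative squares. *)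
Lemma orth_lift (A1 A2 B1 B2 : V) (e : Hom A1 A2) (m : Hom B1 B2)
    (a : Hom A1 B1) (b : Hom A2 B2) :
  orth e m -> m ∘ a = b ∘ e -> exists u : Hom A2 B1, u ∘ e = a /\ m ∘ u = b.
Proof.
  intros H E. rewrite orth_iff in H.
  destruct (H one (a ∘ pi2) (b ∘ pi2)) as [u [[H1 H2] _]].
  { unfold whisk. ccc. now rewrite <- !comp_assoc, E. }
  exists (u ∘ ⟨bang _, idm _⟩). split.
  - apply (f_equal (fun k => k ∘ ⟨bang _, idm _⟩)) in H1.
    unfold whisk in H1. autorewrite with ccc in *. exact H1.
  - now rewrite <- comp_assoc, H2, comp_assoc, pi2_pair, comp_idr.
Qed.

Lemma pre_iso_extend (A1 A2 B : V) (h : Hom A1 A2) (g : Hom A1 B) :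
  is_iso (pre h B) -> exists u : Hom A2 B, u ∘ h = g.
Proof.
  intros [k [_ k2]]. exists (unname (k ∘ name g)).
  rewrite <- (unname_name g). rewrite <- (comp_idl (name g)) at 2. rewrite <- k2.
  unfold pre, unname, name. now ccc.
Qed.

Lemma pre_iso_unique (A1 A2 B : V) (h : Hom A1 A2) (u v : Hom A2 B) :
  is_iso (pre h B) -> u ∘ h = v ∘ h -> u = v.
Proof.
  intros H E. rewrite <- (unname_name u), <- (unname_name v). f_equal.
  apply (iso_mono H). unfold name. rewrite !pre_curry. f_equal.
  unfold whisk. ccc. now rewrite <- !comp_assoc, E.
Qed.

Lemma gcomp_name_r (A1 A2 B W : V) (u : Hom W (exp A2 B)) (h : Hom A1 A2) :
  @gcomp V (self V) A1 A2 B W u (name h ∘ bang W) = pre h B ∘ u.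
Proof. unfold gcomp, name, pre. cbn. now ccc. Qed.

Lemma gcomp_name (A1 A2 A3 : V) (g : Hom A2 A3) (f : Hom A1 A2) :
  @gcomp V (self V) A1 A2 A3 one (name g) (name f) = name (g ∘ f).
Proof. unfold gcomp, name. cbn. now ccc. Qed.

Lemma iso_name (A B : V) (f : Hom A B) :
  @is_iso (Und (self V)) A B (name f) <-> is_iso f.
Proof.
  split; intros [g [g1 g2]].
  - cbn in g, g1, g2. exists (unname g).
    rewrite <- (name_unname g), gcomp_name in g1, g2.
    apply (f_equal unname) in g1, g2. rewrite !unname_name in g1, g2. now split.
  - exists (name g : @Hom (Und (self V)) B A). cbn.
    now rewrite !gcomp_name, g1, g2.
Qed.

Lemma iso_unname (A B : V) (t : @Hom (Und (self V)) A B) :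
  @is_iso (Und (self V)) A B t <-> is_iso (unname t).
Proof. rewrite <- iso_name, name_unname. reflexivity. Qed.

End InternalHoms.

(** * Idempotent enriched monads from universal arrows *)

(** Given arrows [rho] for which composition with [rho A] is an isomorphism from
    the hom object out of [s A] to the one out of [A], at every target [s B], the
    assignment [s] is an idempotent monad. Each identity to be verified holds after
    composition with [rho], so [rho_cancel] proves them all. *)
Section UniversalArrows.
Context {V : CCC} {C : XCat V}.
Variables (s : C -> C) (rho : forall A : C, Hom one (XHom A (s A))).
Variable ext : forall A B : C, Hom (XHom A (s B)) (XHom (s A) (s B)).
Hypothesis ext_rho : forall (A B : C) (W : V) (f : Hom W (XHom A (s B))),
  (ext A B ∘ f) ⊚ (rho A ∘ bang W) = f.
Hypothesis rho_cancel : forall (A B : C) (W : V) (u v : Hom W (XHom (s A) (s B))),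
  u ⊚ (rho A ∘ bang W) = v ⊚ (rho A ∘ bang W) -> u = v.

Definition universal_hom (A B : C) : Hom (XHom A B) (XHom (s A) (s B)) :=
  ext A B ∘ ((rho B ∘ bang _) ⊚ idm _).

Lemma universal_hom_rho (A B : C) (W : V) (f : Hom W (XHom A B)) :
  (universal_hom A B ∘ f) ⊚ (rho A ∘ bang W) = (rho B ∘ bang W) ⊚ f.
Proof.
  unfold universal_hom. rewrite comp_assoc, ext_rho, gcomp_comp.
  now rewrite comp_assoc, bang_comp, comp_idl.
Qed.

Definition universal_fun : XFun C C.
Proof.
  refine {| fob := s; fhom := universal_hom |}.
  - intros A1 A2 A3. apply rho_cancel. rewrite universal_hom_rho.
    change (xcomp ∘ ⟨universal_hom A2 A3 ∘ pi1, universal_hom A1 A2 ∘ pi2⟩)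
      with ((universal_hom A2 A3 ∘ pi1) ⊚ (universal_hom A1 A2 ∘ pi2)).
    rewrite gcomp_assoc, universal_hom_rho, <- gcomp_assoc, universal_hom_rho, gcomp_assoc.
    unfold gcomp. now rewrite pair_id, comp_idr.
  - intros A. apply rho_cancel.
    rewrite universal_hom_rho, <- (comp_bang1 (xid A)), <- (comp_bang1 (xid (s A))).
    now rewrite gcomp_idl, gcomp_idr.
Defined.

Definition universal_unit : XNat (idX C) universal_fun.
Proof.
  refine {| ncomp := fun A => rho A : Hom one (XHom (idX C A) (universal_fun A)) |}.
  intros A B. symmetry. pose proof (universal_hom_rho (idm (XHom A B))) as H.
  rewrite comp_idr in H. exact H.
Defined.

Definition universal_mult (A : C) : Hom one (XHom (s (s A)) (s A)) := ext (s A) A ∘ xid (s A).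

Lemma universal_mult_rho (A : C) (W : V) :
  (universal_mult A ∘ bang W) ⊚ (rho (s A) ∘ bang W) = xid (s A) ∘ bang W.
Proof. unfold universal_mult. now rewrite comp_assoc, ext_rho. Qed.

Definition universal_mu : XNat (compX universal_fun universal_fun) universal_fun.
Proof.
  refine {| ncomp := fun A => universal_mult A
    : Hom one (XHom (compX universal_fun universal_fun A) (universal_fun A)) |}.
  intros A B. cbn.
  change ((universal_mult B ∘ bang _) ⊚ (universal_hom (s A) (s B) ∘ universal_hom A B)
    = universal_hom A B ⊚ (universal_mult A ∘ bang _)).
  apply rho_cancel. rewrite !gcomp_assoc, universal_hom_rho, universal_mult_rho, <- gcomp_assoc.
  now rewrite universal_mult_rho, gcomp_idl, gcomp_idr.
Defined.

Lemma rho_cancel1 (A B : C) (u v : Hom one (XHom (s A) (s B))) :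
  u ⊚ rho A = v ⊚ rho A -> u = v.
Proof. intros H. apply rho_cancel. now rewrite comp_bang1. Qed.

Lemma universal_hom_rho1 (A B : C) (f : Hom one (XHom A B)) :
  (universal_hom A B ∘ f) ⊚ rho A = rho B ⊚ f.
Proof. pose proof (universal_hom_rho f) as H. now rewrite !comp_bang1 in H. Qed.

Lemma universal_mult_rho1 (A : C) : universal_mult A ⊚ rho (s A) = xid (s A).
Proof. pose proof (universal_mult_rho A one) as H. now rewrite !comp_bang1 in H. Qed.

Definition universal_monad : XMonad C.
Proof.
  refine {| mfun := universal_fun; eta := universal_unit; mu := universal_mu |}; intros A; cbn.
  - apply rho_cancel1.
    now rewrite gcomp_assoc, universal_hom_rho1, <- gcomp_assoc, universal_mult_rho1.
  - apply universal_mult_rho1.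
  - apply rho_cancel1.
    rewrite !gcomp_assoc, universal_hom_rho1, <- gcomp_assoc, !universal_mult_rho1.
    now rewrite gcomp_idl1, gcomp_idr1.
Defined.

Lemma universal_idempotent : idempotent universal_monad.
Proof.
  intros A. exists (rho (s A)). cbn. split; [|apply universal_mult_rho1].
  apply rho_cancel1.
  now rewrite gcomp_assoc, universal_mult_rho1, gcomp_idl1, gcomp_idr1.
Qed.

End UniversalArrows.

(** Fixed objects are orthogonal to the morphisms that [S] inverts. *)
Section Fixed.
Context {V : CCC} {C : XCat V} (S : XMonad C).

Let n (A : C) : Hom one (XHom A (S A)) := eta S A.

Lemma unit_gnat (A B : C) (W : V) (f : Hom W (XHom A B)) :
  (n B ∘ bang W) ⊚ f = (fhom S ∘ f) ⊚ (n A ∘ bang W).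
Proof. exact (eta_gnat S f). Qed.

Lemma unit_cancel (A B : C) (W : V) (u v : Hom W (XHom A B)) :
  fixed S B -> (n B ∘ bang W) ⊚ u = (n B ∘ bang W) ⊚ v -> u = v.
Proof. intros H E. exact (eta_cancel H E). Qed.

(** The extension of [g] along [t] is the composite of the unit, the inverse of
    S(t), S(g), and the inverse of the unit at [B]. *)
Lemma fixed_extension (A1 A2 B : C) (t : Hom one (XHom A1 A2)) (W : V)
    (g : Hom W (XHom A1 B)) :
  @is_iso (Und C) (S A1) (S A2) (fhom S ∘ t) -> fixed S B ->
  exists u : Hom W (XHom A2 B), u ⊚ (t ∘ bang W) = g.
Proof.
  intros [k [k1 _]] HB. cbn in k, k1.
  pose proof (inv_eta_l HB : inv_eta HB ⊚ n B = xid B) as i1.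
  exists ((inv_eta HB ∘ bang W)
    ⊚ ((fhom S ∘ g) ⊚ ((k ∘ bang W) ⊚ (n A2 ∘ bang W)))).
  rewrite !gcomp_assoc, unit_gnat, <- (gcomp_assoc (k ∘ bang W)).
  rewrite <- (comp_assoc (fhom S)), <- gcomp_comp, k1, gcomp_idl, <- unit_gnat.
  now rewrite <- gcomp_assoc, <- gcomp_comp, i1, gcomp_idl.
Qed.

Lemma fixed_cancel (A1 A2 B : C) (t : Hom one (XHom A1 A2)) (W : V)
    (u v : Hom W (XHom A2 B)) :
  @is_iso (Und C) (S A1) (S A2) (fhom S ∘ t) -> fixed S B ->
  u ⊚ (t ∘ bang W) = v ⊚ (t ∘ bang W) -> u = v.
Proof.
  intros [k [_ k2]] HB E. cbn in k, k2.
  apply (unit_cancel HB). rewrite !unit_gnat. f_equal.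
  apply (f_equal (fun z => (fhom S ∘ z) ⊚ (k ∘ bang W))) in E.
  rewrite !fhom_gcomp, !gcomp_assoc, <- comp_assoc, <- gcomp_comp, k2 in E.
  now rewrite !gcomp_idr in E.
Qed.

End Fixed.

(** * The idempotent core *)

Section Core.
Context {V : CCC}.

Section Monad.
Variable T : XMonad (self V).

Lemma umap_id (A : V) : umap T (idm A) = idm (T A : V).
Proof.
  unfold umap. refine (eq_trans (f_equal unname (fhom_id T A)) _). apply unname_name.
Qed.

Lemma umap_comp (A B D : V) (g : Hom B D) (f : Hom A B) :
  umap T (g ∘ f) = umap T g ∘ umap T f.
Proof.
  rewrite <- (unname_name (umap T g ∘ _)). unfold umap at 1. f_equal.
  rewrite <- !gcomp_name. unfold umap. rewrite !name_unname.
  apply (fhom_gcomp T (A1 := A) (A2 := B) (A3 := D)).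
Qed.

Lemma ueta_nat (A B : V) (f : Hom A B) : ueta T B ∘ f = umap T f ∘ ueta T A.
Proof.
  rewrite <- (unname_name (ueta T B ∘ _)), <- (unname_name (umap T f ∘ _)). f_equal.
  rewrite <- !gcomp_name. unfold ueta, umap. rewrite !name_unname.
  apply (eta_nat1 T (A := A) (B := B)).
Qed.

Lemma Sigma_cancel_l (A B D : V) (g : Hom B D) (f : Hom A B) :
  Sigma T g -> Sigma T (g ∘ f) -> Sigma T f.
Proof. unfold Sigma. rewrite umap_comp. apply iso_cancel_l. Qed.

Lemma Sigma_cancel_r (A B D : V) (g : Hom B D) (f : Hom A B) :
  Sigma T f -> Sigma T (g ∘ f) -> Sigma T g.
Proof. unfold Sigma. rewrite umap_comp. apply iso_cancel_r. Qed.

Lemma Sigma_comp (A B D : V) (g : Hom B D) (f : Hom A B) :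
  Sigma T g -> Sigma T f -> Sigma T (g ∘ f).
Proof. unfold Sigma. rewrite umap_comp. apply iso_comp. Qed.

Lemma Sigma_iso (A B : V) (f : Hom A B) : is_iso f -> Sigma T f.
Proof.
  intros [g [g1 g2]]. exists (umap T g). now rewrite <- !umap_comp, g1, g2, !umap_id.
Qed.

(** Extending the identity of [A] along [h] gives a left inverse of [h], and
    uniqueness of extensions into [B] makes it two-sided. *)
Lemma complete_Sigma_iso (A B : V) (h : Hom A B) :
  T_complete T A -> T_complete T B -> Sigma T h -> is_iso h.
Proof.
  intros HA HB Hh. destruct (pre_iso_extend (idm A) (HA _ _ h Hh)) as [g Hg].
  exists g. split; [exact Hg|].
  apply (pre_iso_unique (HB _ _ h Hh)). now rewrite comp_assoc, Hg, comp_idl, comp_idr.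
Qed.

(** A map into [B] extends after composition with [m], and orthogonality lifts the
    extension back to [B]. *)
Lemma closed_complete (B Y : V) (m : Hom B Y) :
  T_closed T m -> T_complete T Y -> T_complete T B.
Proof.
  intros [Hm Mm] HY A1 A2 h Hh. apply pre_iso_iff. intros W g.
  pose proof (HY _ _ h Hh) as E. rewrite pre_iso_iff in E.
  destruct (E W (m ∘ g)) as [b [Hb _]].
  pose proof (Hm _ _ h Hh) as O. rewrite orth_iff in O.
  destruct (O W g b (eq_sym Hb)) as [u [[H1 H2] Hu]].
  exists u. split; [exact H1|]. intros v Hv. apply Hu. split; [exact Hv|].
  pose proof (iso_mono (HY _ _ h Hh)) as Mh.
  apply curry_inj, Mh. rewrite !pre_curry. f_equal. now rewrite comp_assoc, Hv, Hb.
Qed.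

End Monad.

Lemma fixed_ueta (S : XMonad (self V)) (B : V) : fixed S B <-> is_iso (ueta S B).
Proof. apply iso_unname. Qed.

Lemma Sigma_ueta (S : XMonad (self V)) (A : V) : idempotent S -> Sigma S (ueta S A).
Proof.
  intros HS. unfold Sigma, umap, ueta. rewrite name_unname.
  pose proof (eta_free HS A) as E. cbn in E |- *. rewrite <- E.
  apply fixed_ueta, (fixed_free HS).
Qed.

Lemma fixed_extend (S : XMonad (self V)) (A1 A2 B : V) (h : Hom A1 A2) :
  Sigma S h -> fixed S B -> is_iso (pre h B).
Proof.
  intros Hh HB. apply iso_unname in Hh.
  destruct (fixed_extension (C := self V) (A1 := A1) (A2 := A2) (B := B)
    (idm (exp A1 B)) Hh HB) as [k Hk].
  cbn in k.
  apply mono_retraction_iso with k; [|exact (eq_trans (eq_sym (gcomp_name_r k h)) Hk)].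
  intros W u v E. rewrite <- !gcomp_name_r in E.
  exact (fixed_cancel (C := self V) (A1 := A1) (A2 := A2) Hh HB E).
Qed.

(** Fixed objects are orthogonal to [Sigma S], which is [Sigma T]. Conversely
    the unit of an idempotent monad at [B] belongs to [Sigma S], so it is
    invertible as soon as its source is complete, its target being fixed. *)
Lemma core_fixed (T S : XMonad (self V)) (HS : idempotent_core T S) (B : V) :
  fixed S B <-> T_complete T B.
Proof.
  split.
  - intros HB A1 A2 h Hh. apply (fixed_extend (S := S)); [|exact HB].
    now apply (core_inverts HS).
  - intros HB. apply fixed_ueta. apply (complete_Sigma_iso (T := T)); [exact HB| |].
    + intros A1 A2 h Hh. apply (fixed_extend (S := S)).
      * now apply (core_inverts HS).
      * apply fixed_free, (core_idempotent HS).
    + apply (core_inverts HS). apply Sigma_ueta, (core_idempotent HS).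
Qed.

Lemma choose_family (A : Type) (B : A -> Type) (R : forall a, B a -> Prop) :
  (forall a, exists b, R a b) -> exists f : forall a, B a, forall a, R a (f a).
Proof.
  intros H. exists (fun a => proj1_sig (constructive_indefinite_description _ (H a))).
  intros a. exact (proj2_sig (constructive_indefinite_description _ (H a))).
Qed.

(** The monad of the chosen reflections inverts [f] iff T does: in the naturality
    square of [f] the two reflections are in [Sigma T], so T inverts [f] iff it
    inverts the reflected morphism, which runs between complete objects. *)
Lemma core_exists (T : XMonad (self V)) :
  (forall A : V, exists (B : V) (r : Hom A B), Sigma T r /\ T_complete T B) ->
  exists S : XMonad (self V), idempotent_core T S.
Proof.
  intros H.
  apply choose_family in H as [s H].
  apply choose_family in H as [r H].
  assert (K : forall P : V * V, exists k : Hom (exp (fst P) (s (snd P))) _,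
    pre (r (fst P)) (s (snd P)) ∘ k = idm _).
  { intros [A B]. destruct (proj2 (H B) _ _ (r A) (proj1 (H A))) as [k [_ Hk]].
    now exists k. }
  apply choose_family in K as [e K].
  unshelve epose (S := @universal_monad V (self V) s (fun A => name (r A))
    (fun A B => e (A, B)) _ _).
  { intros A B W f. refine (eq_trans (gcomp_name_r _ (r A)) _).
    refine (eq_trans (eq_sym (comp_assoc _ (e (A, B)) f)) _).
    exact (eq_trans (f_equal (fun z => z ∘ f) (K (A, B))) (comp_idl f)). }
  { intros A B W u v E.
    apply (iso_mono (proj2 (H B) _ _ _ (proj1 (H A)))).
    refine (eq_trans (eq_sym (gcomp_name_r u (r A))) _).
    exact (eq_trans E (gcomp_name_r v (r A))). }
  exists S. split; [apply universal_idempotent|].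
  assert (Er : forall A, ueta S A = r A) by (intros A; apply unname_name).
  assert (N : forall A B (f : Hom A B), r B ∘ f = umap S f ∘ r A).
  { intros A B f. rewrite <- !Er. exact (ueta_nat S f). }
  assert (St : forall A B (f : Hom A B), Sigma T (umap S f) <-> Sigma T f).
  { intros A B f. split; intros Hf.
    - apply Sigma_cancel_l with (g := r B); [apply H|]. rewrite N.
      apply Sigma_comp; [exact Hf|apply H].
    - apply Sigma_cancel_r with (f := r A); [apply H|]. rewrite <- N.
      apply Sigma_comp; [apply H|exact Hf]. }
  intros A B f. rewrite <- St. split.
  - intros Hf. now apply Sigma_iso.
  - intros Hf. apply complete_Sigma_iso with (T := T); [apply H|apply H|exact Hf].
Qed.

End Core.

(** * Double dualization *)

Section DoubleDualization.
Context {V : CCC} (R : V).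

Lemma dual_name (A B : V) (f : Hom A B) :
  @fhom V (opX (self V)) (self V) (dual R) B A ∘ name f = name (pre f R).
Proof.
  unfold name at 2. cbn. rewrite curry_comp. f_equal. apply curry_ext.
  unfold name, pre. now ccc.
Qed.

Lemma umap_double_dual (A B : V) (f : Hom A B) :
  umap (double_dual R) f = pre (pre f R) R.
Proof.
  rewrite <- (unname_name (pre _ R)), <- !dual_name. unfold umap. f_equal.
  apply comp_assoc.
Qed.

Lemma ueta_double_dual (A : V) : ueta (double_dual R) A = dual_ev R A.
Proof. exact (unname_name (dual_ev R A)). Qed.

Lemma dual_ev_nat (A B : V) (f : Hom A B) :
  dual_ev R B ∘ f = pre (pre f R) R ∘ dual_ev R A.
Proof. unfold dual_ev. rewrite pre_curry. unfold pre, whisk. now ccc. Qed.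

Lemma dual_ev_triangle (A : V) : pre (dual_ev R A) R ∘ dual_ev R (exp A R) = idm _.
Proof.
  unfold dual_ev at 2. rewrite pre_curry. apply curry_ext.
  unfold whisk, dual_ev. now ccc.
Qed.

(** If [k] inverts DDf, the transpose of [k] after the unit at [B] inverts Df:
    both composites reduce to the triangle identity by naturality of the unit. *)
Lemma Sigma_double_dual (A B : V) (f : Hom A B) :
  Sigma (double_dual R) f <-> is_iso (pre f R).
Proof.
  assert (E : Sigma (double_dual R) f <-> is_iso (pre (pre f R) R)).
  { pose proof (umap_double_dual f) as E.
    exact (eq_ind_r (fun t : Hom (exp (exp A R) R) (exp (exp B R) R) =>
      is_iso t <-> is_iso (pre (pre f R) R)) (iff_refl _) E). }
  split; [intros H; apply E in H|intros H; now apply E, pre_iso].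
  assert (H' : exists k : Hom (exp (exp B R) R) (exp (exp A R) R),
    k ∘ pre (pre f R) R = idm _ /\ pre (pre f R) R ∘ k = idm _) by exact H.
  destruct H' as [k [k1 k2]].
  exists (pre (k ∘ dual_ev R B) R ∘ dual_ev R (exp A R)). split.
  - rewrite comp_assoc, dual_ev_nat, <- comp_assoc, <- pre_comp.
    rewrite <- comp_assoc, k2, comp_idl. apply dual_ev_triangle.
  - rewrite <- comp_assoc, <- pre_comp, comp_assoc, dual_ev_nat.
    rewrite <- comp_assoc, k1, comp_idl. apply dual_ev_triangle.
Qed.

Lemma complete_dualizer : T_complete (double_dual R) R.
Proof. intros A1 A2 h Hh. exact (proj1 (Sigma_double_dual h) Hh). Qed.

Lemma complete_double_dual (A : V) : T_complete (double_dual R) (exp (exp A R) R).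
Proof. intros A1 A2 h Hh. apply pre_iso_power. now apply complete_dualizer. Qed.

(** The triangle identity gives De ∘ Dc a section, hence also De; a monomorphism
    with a section is invertible. *)
Lemma Sigma_of_unit_factor (A B : V) (e : Hom A B) (c : Hom B (exp (exp A R) R)) :
  c ∘ e = dual_ev R A -> is_mono (pre e R) -> Sigma (double_dual R) e.
Proof.
  intros E M. apply Sigma_double_dual.
  apply mono_retraction_iso with (pre c R ∘ dual_ev R (exp A R)); [exact M|].
  rewrite <- comp_assoc, <- pre_comp, E. apply dual_ev_triangle.
Qed.

End DoubleDualization.

(** * Truth values and subobjects *)

Section Subobjects.
Context {X : Topos}.

Definition truth (A : X) : Hom A Omega := tru ∘ bang A.

Lemma truth_comp (A B : X) (f : Hom A B) : truth B ∘ f = truth A.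
Proof. unfold truth. now rewrite comp_assoc, bang_comp. Qed.

Lemma chi_truth (U A W : X) (m : Hom U A) (Hm : is_mono m) (w : Hom W A) :
  chi Hm ∘ w = truth W <-> exists w' : Hom W U, m ∘ w' = w.
Proof.
  destruct (chi_pullback Hm) as [E H]. split.
  - intros K. destruct (H W w (bang W) K) as [u [[Hu _] _]]. now exists u.
  - intros [w' <-]. rewrite <- comp_assoc, E. apply truth_comp.
Qed.

Lemma classified_truth (A W : X) (phi : Hom A Omega) (w : Hom W A) :
  phi ∘ w = truth W <->
  exists w' : Hom W (sdom (classified phi)), sarr (classified phi) ∘ w' = w.
Proof. rewrite <- (chi_classified phi) at 1. apply chi_truth. Qed.

(** This reduces every identity between classifying maps to a comparison of
    generalized elements. *)
Lemma omega_ext (A : X) (phi psi : Hom A Omega) :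
  (forall (W : X) (w : Hom W A), phi ∘ w = truth W <-> psi ∘ w = truth W) -> phi = psi.
Proof.
  intros H. rewrite <- (chi_classified psi). apply chi_uniq.
  set (m := classified psi). split.
  - apply H. apply classified_truth. exists (idm _). apply comp_idr.
  - intros W a b E. rewrite (bang_uniq b) in E.
    destruct (proj1 (classified_truth psi a) (proj1 (H _ a) E)) as [u Hu].
    exists u. split.
    + split; [exact Hu|apply hom_one_eq].
    + intros v [Hv _]. apply (smono m). exact (eq_trans Hu (eq_sym Hv)).
Qed.

Lemma and_omega_truth (A W : X) (phi psi : Hom A Omega) (w : Hom W A) :
  and_omega ∘ ⟨phi, psi⟩ ∘ w = truth W <-> phi ∘ w = truth W /\ psi ∘ w = truth W.
Proof.
  unfold and_omega. rewrite comp_assoc, chi_truth, pair_comp. split.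
  - intros [w' E]. rewrite pair_comp, (bang_uniq w') in E.
    pose proof (f_equal (fun k => pi1 ∘ k) E) as E1.
    pose proof (f_equal (fun k => pi2 ∘ k) E) as E2.
    cbn in E1, E2. rewrite !pi1_pair in E1. rewrite !pi2_pair in E2. now split.
  - intros [-> ->]. exists (bang W). apply pair_comp.
Qed.

Lemma iso_of_chi_truth (U A : X) (m : Hom U A) (Hm : is_mono m) :
  chi Hm = truth A -> is_iso m.
Proof.
  intros E. destruct (proj1 (chi_truth Hm (idm A))) as [g Hg].
  { now rewrite comp_idr. }
  now apply mono_retraction_iso with g.
Qed.

(** A monomorphism is the equalizer of its classifying map and truth, and an
    epimorphism cannot distinguish the two maps. *)
Lemma balanced (A B : X) (f : Hom A B) : is_mono f -> is_epi f -> is_iso f.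
Proof.
  intros Hm He. apply (iso_of_chi_truth (Hm := Hm)). apply He.
  rewrite truth_comp. apply chi_truth. exists (idm A). apply comp_idr.
Qed.

Lemma sub_iso_iff (A : X) (m n : Sub A) : sub_iso m n <-> sub_chi m = sub_chi n.
Proof.
  split.
  - intros [u [[v [_ uv]] E]]. apply omega_ext. intros W w. unfold sub_chi.
    rewrite !chi_truth. split; intros [w' <-].
    + exists (u ∘ w'). now rewrite <- comp_assoc, E.
    + exists (v ∘ w'). now rewrite <- E, comp_assoc, <- (comp_assoc u), uv, comp_idl.
  - intros E.
    destruct (proj1 (chi_truth (smono n) (sarr m))) as [u Hu].
    { change (sub_chi n ∘ sarr m = truth _). rewrite <- E. apply chi_truth.
      exists (idm _). apply comp_idr. }
    destruct (proj1 (chi_truth (smono m) (sarr n))) as [v Hv].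
    { change (sub_chi m ∘ sarr n = truth _). rewrite E. apply chi_truth.
      exists (idm _). apply comp_idr. }
    exists u. split; [|exact Hu]. exists v. split.
    + apply (smono m). now rewrite <- comp_assoc, Hv, Hu, comp_idr.
    + apply (smono n). now rewrite <- comp_assoc, Hu, Hv, comp_idr.
Qed.

(** * Images *)

(** Multiplication by [W] is a left adjoint, hence preserves epimorphisms. *)
Lemma whisk_epi (W A B : X) (e : Hom A B) : is_epi e -> is_epi (whisk W e).
Proof.
  intros He Z u v E.
  assert (T : forall w : Hom (bprod W B) Z, curry (w ∘ ⟨pi2, pi1⟩) ∘ e
      = curry (w ∘ whisk W e ∘ ⟨pi2, pi1⟩)).
  { intros w. rewrite curry_comp. unfold whisk. now ccc. }
  assert (K : curry (u ∘ ⟨pi2, pi1⟩) = curry (v ∘ ⟨pi2, pi1⟩)).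
  { apply He. now rewrite !T, E. }
  apply curry_inj in K. apply (f_equal (fun z => z ∘ ⟨pi2, pi1⟩)) in K.
  autorewrite with ccc in K. exact K.
Qed.

(** The image is the intersection of all subobjects of [B] through which [f]
    factors, taken internally: [K] is the object of predicates on [B] that hold
    along [f], and [m] consists of the elements of [B] that satisfy every member of
    [K]. The corestriction [e] is epic because the equalizer of two maps that agree
    on [e] is a subobject of [B] through which [f] factors, hence contains [m]. *)
Lemma image (A B : X) (f : Hom A B) :
  exists (m : Sub B) (e : Hom A (sdom m)), is_epi e /\ f = sarr m ∘ e.
Proof.
  pose (K := equ (pre f Omega) (curry (truth (bprod (exp B Omega) A)))).
  pose (k := equ_arr (pre f Omega) (curry (truth (bprod (exp B Omega) A))) : Hom K _).
  assert (Kf : ev ∘ ⟨k ∘ pi1, f ∘ pi2⟩ = truth (bprod K A)).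
  { assert (E : pre f Omega ∘ k = curry (truth _) ∘ k) by apply equ_eq.
    rewrite curry_comp, truth_comp in E. apply curry_inj. rewrite <- E.
    unfold pre. now ccc. }
  assert (Ku : forall s : Hom one (exp B Omega),
    pre f Omega ∘ s = curry (truth _) -> exists s' : Hom one K, k ∘ s' = s).
  { intros s Hs. destruct (@equ_univ X _ _ (pre f Omega) (curry (truth _)) one s)
      as [s' [Hs' _]].
    - now rewrite Hs, curry_comp, truth_comp.
    - now exists s'. }
  clearbody k. clearbody K.
  pose (a := curry (ev ∘ ⟨k ∘ pi2, pi1⟩) : Hom B (exp K Omega)).
  pose (b := curry (truth (bprod B K)) : Hom B (exp K Omega)).
  pose (m := {| sarr := equ_arr a b; smono := @equ_mono _ _ _ _ _ |} : Sub B).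
  assert (Em : forall W (x : Hom W B), ev ∘ ⟨k ∘ pi2, x ∘ pi1⟩ = truth (bprod W K) <->
    exists x' : Hom W (sdom m), sarr m ∘ x' = x).
  { intros W x. split.
    - intros E. destruct (@equ_univ X _ _ a b W x) as [x' [Hx' _]].
      + unfold a, b. rewrite !curry_comp, truth_comp. f_equal. rewrite <- E. now ccc.
      + now exists x'.
    - intros [x' <-]. assert (E : a ∘ sarr m = b ∘ sarr m) by apply equ_eq.
      apply (f_equal (fun z => z ∘ x')) in E. unfold a, b in E.
      rewrite !comp_assoc, !curry_comp, truth_comp in E.
      apply curry_inj. rewrite <- E. f_equal. now ccc. }
  clearbody m. clear a b.
  destruct (proj1 (Em A f)) as [e He].
  { rewrite <- (truth_comp (⟨pi2, pi1⟩)), <- Kf. now ccc. }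
  exists m, e. split; [|easy]. intros W u v E.
  pose (n := sarr m ∘ equ_arr u v).
  assert (Mn : is_mono n) by (apply mono_comp; [apply smono|apply equ_mono]).
  destruct (Ku (name (chi Mn))) as [s Hs].
  { unfold name. rewrite pre_curry. f_equal. unfold whisk.
    rewrite comp_assoc, pi2_pair. apply chi_truth.
    destruct (@equ_univ X _ _ u v A e E) as [e' [He' _]].
    exists (e' ∘ pi2). unfold n. now rewrite <- !comp_assoc, (comp_assoc (sarr m)), He', He. }
  destruct (proj1 (chi_truth Mn (sarr m))) as [t Ht].
  { pose proof (proj2 (Em _ (sarr m)) (ex_intro _ (idm _) (comp_idr _))) as Q.
    apply (f_equal (fun z => z ∘ ⟨idm _, s ∘ bang _⟩)) in Q.
    rewrite truth_comp in Q. rewrite <- Q.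
    rewrite !comp_assoc, pair_comp, !comp_assoc, pi1_pair, pi2_pair, comp_idr.
    rewrite <- (comp_assoc k), Hs. unfold name. now ccc. }
  assert (T1 : equ_arr u v ∘ t = idm _).
  { apply (smono m). unfold n in Ht. now rewrite <- comp_assoc, Ht, comp_idr. }
  rewrite <- (comp_idr u), <- (comp_idr v), <- T1, <- !comp_assoc. now rewrite equ_eq.
Qed.

End Subobjects.

(** * Closure and density for a Lawvere-Tierney topology *)

Section Topology.
Context {X : Topos} (j : LawvereTierney X).

Lemma j_truth (A : X) : j ∘ truth A = truth A.
Proof. unfold truth. now rewrite <- comp_assoc, j_tru. Qed.

Lemma j_j (A : X) (phi : Hom A Omega) : j ∘ (j ∘ phi) = j ∘ phi.
Proof. now rewrite <- comp_assoc, j_idem. Qed.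

Lemma j_and_pair (A : X) (phi psi : Hom A Omega) :
  j ∘ (and_omega ∘ ⟨phi, psi⟩) = and_omega ∘ ⟨j ∘ phi, j ∘ psi⟩.
Proof. rewrite <- comp_assoc, j_and. now ccc. Qed.

Lemma chi_arr (A : X) (m : Sub A) : sub_chi m ∘ sarr m = truth _.
Proof. apply chi_truth. exists (idm _). apply comp_idr. Qed.

Lemma chi_closure (A : X) (m : Sub A) : sub_chi (j_closure j m) = j ∘ sub_chi m.
Proof. apply chi_classified. Qed.

Lemma j_closed_iff (A : X) (m : Sub A) : j_closed j m <-> j ∘ sub_chi m = sub_chi m.
Proof. unfold j_closed. now rewrite sub_iso_iff, chi_closure. Qed.

Lemma closure_closed (A : X) (m : Sub A) : j_closed j (j_closure j m).
Proof. apply j_closed_iff. now rewrite chi_closure, j_j. Qed.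

Lemma closure_total (A : X) (m : Sub A) :
  is_total (j_closure j m) <-> j ∘ sub_chi m = truth A.
Proof.
  rewrite <- chi_closure. split.
  - intros [g [_ Hg]].
    rewrite <- (comp_idr (sub_chi _)), <- Hg, <- comp_assoc, chi_arr. apply truth_comp.
  - intros E. exact (iso_of_chi_truth E).
Qed.

(** Closure is inflationary because [j] preserves truth. *)
Lemma closure_factor (A : X) (m : Sub A) :
  exists d : Hom (sdom m) (sdom (j_closure j m)), sarr (j_closure j m) ∘ d = sarr m.
Proof. apply classified_truth. now rewrite comp_assoc, chi_arr, j_truth. Qed.

(** Toposes are balanced, so a monomorphism is its own image. *)
Lemma j_dense_mono (D A : X) (d : Hom D A) (Hd : is_mono d) :
  j_dense j d <-> j ∘ chi Hd = truth A.
Proof.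
  split.
  - intros [m [e [He [E Ht]]]]. apply closure_total in Ht.
    assert (Ie : is_iso e).
    { apply balanced; [|exact He]. rewrite E in Hd. exact (mono_right_factor Hd). }
    rewrite <- Ht. f_equal. apply (proj1 (sub_iso_iff (Build_Sub Hd) m)).
    exists e. now split.
  - intros H. exists (Build_Sub Hd), (idm D). split; [apply iso_epi, iso_id|].
    split; [symmetry; apply comp_idr|]. now apply closure_total.
Qed.

(** Pulling [m] back along [c] gives [d], and closure commutes with pullback; if
    [c] is the closure of [m], its pullback along itself is everything. *)
Lemma dense_in_closure (A : X) (m c : Sub A) (d : Hom (sdom m) (sdom c)) (Hd : is_mono d) :
  sarr c ∘ d = sarr m -> j ∘ sub_chi m = sub_chi c -> j ∘ chi Hd = truth _.
Proof.
  intros E H.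
  assert (K : chi Hd = sub_chi m ∘ sarr c).
  { apply omega_ext. intros W w. unfold sub_chi. rewrite comp_assoc, !chi_truth.
    split; intros [w' Hw]; exists w'.
    - now rewrite <- E, comp_assoc, Hw.
    - apply (smono c). now rewrite <- comp_assoc, E. }
  rewrite K, <- comp_assoc, H. apply chi_arr.
Qed.

Lemma chi_whisk (W D A : X) (d : Hom D A) (Hd : is_mono d) (Hw : is_mono (whisk W d)) :
  chi Hw = chi Hd ∘ pi2.
Proof.
  apply omega_ext. intros Z w. rewrite comp_assoc, !chi_truth. split; intros [w' E].
  - exists (pi2 ∘ w'). rewrite <- E. unfold whisk. now ccc.
  - exists (⟨pi1 ∘ w, w'⟩). unfold whisk. apply pair_ext; ccc; [reflexivity|exact E].
Qed.

Lemma whisk_mono (W D A : X) (d : Hom D A) : is_mono d -> is_mono (whisk W d).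
Proof.
  intros Hd Z u v E. unfold whisk in E. rewrite !pair_comp in E.
  pose proof (f_equal (fun k => pi1 ∘ k) E) as E1.
  pose proof (f_equal (fun k => pi2 ∘ k) E) as E2. cbn in E1, E2.
  rewrite !pi1_pair in E1. rewrite !pi2_pair, !comp_assoc in E2.
  apply pair_ext; [exact E1|now apply Hd].
Qed.

Lemma whisk_dense (W D A : X) (d : Hom D A) (Hd : is_mono d) (Hw : is_mono (whisk W d)) :
  j ∘ chi Hd = truth A -> j ∘ chi Hw = truth _.
Proof. intros E. rewrite (chi_whisk Hd), <- comp_assoc, E. apply truth_comp. Qed.

(** * The object of closed truth values is a sheaf *)

Definition iota : Hom (Omega_j j) Omega := equ_arr j (idm Omega).

Lemma j_iota : j ∘ iota = iota.
Proof. exact (eq_trans (equ_eq _ _) (comp_idl _)). Qed.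

Lemma iota_mono : is_mono iota.
Proof. apply equ_mono. Qed.

Lemma iota_lift (A : X) (phi : Hom A Omega) :
  j ∘ phi = phi -> exists psi : Hom A (Omega_j j), iota ∘ psi = phi.
Proof.
  intros E. destruct (@equ_univ X _ _ j (idm Omega) A phi) as [u [Hu _]].
  - now rewrite comp_idl.
  - now exists u.
Qed.

(** On closed truth values, [phi] is the closure of its meet with a dense
    subobject, since [j] preserves meets; that meet only depends on the
    restriction of [phi]. *)
Lemma closed_eq_of_dense (D A : X) (d : Hom D A) (Hd : is_mono d) (phi psi : Hom A Omega) :
  j ∘ chi Hd = truth A -> j ∘ phi = phi -> j ∘ psi = psi ->
  phi ∘ d = psi ∘ d -> phi = psi.
Proof.
  intros Ht Hphi Hpsi E.
  assert (K : forall a : Hom A Omega, j ∘ a = a -> a = j ∘ (and_omega ∘ ⟨a, chi Hd⟩)).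
  { intros a Ha. rewrite j_and_pair, Ha, Ht. apply omega_ext. intros W w.
    rewrite and_omega_truth, truth_comp. tauto. }
  rewrite (K phi Hphi), (K psi Hpsi). f_equal. apply omega_ext. intros W w.
  rewrite !and_omega_truth, !chi_truth. split; intros [H [w' <-]]; split.
  - now rewrite <- comp_assoc, <- E, comp_assoc.
  - now exists w'.
  - now rewrite <- comp_assoc, E, comp_assoc.
  - now exists w'.
Qed.

Lemma dense_cancel_iota (D A : X) (d : Hom D A) (Hd : is_mono d) (u v : Hom A (Omega_j j)) :
  j ∘ chi Hd = truth A -> u ∘ d = v ∘ d -> u = v.
Proof.
  intros Ht E. apply iota_mono. apply (closed_eq_of_dense Ht).
  - now rewrite <- comp_assoc, j_iota.
  - now rewrite <- comp_assoc, j_iota.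
  - now rewrite !comp_assoc, E.
Qed.

(** A closed truth value on [D] classifies a subobject of [D], hence of [A]; the
    closure of the latter restricts to the given one. *)
Lemma Omega_j_extend (D A : X) (d : Hom D A) (Hd : is_mono d) (g : Hom D (Omega_j j)) :
  exists u : Hom A (Omega_j j), u ∘ d = g.
Proof.
  pose (G := classified (iota ∘ g)).
  assert (HG : is_mono (d ∘ sarr G)) by (apply mono_comp; [exact Hd|apply smono]).
  assert (E : chi HG ∘ d = iota ∘ g).
  { apply omega_ext. intros W w. rewrite (classified_truth (iota ∘ g)).
    rewrite comp_assoc, chi_truth. fold G. split; intros [w' H]; exists w'.
    - apply Hd. now rewrite <- comp_assoc.
    - now rewrite comp_assoc, H. }
  destruct (iota_lift (phi := j ∘ chi HG)) as [u Hu]; [apply j_j|].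
  exists u. apply iota_mono.
  now rewrite <- comp_assoc, Hu, comp_assoc, E, <- comp_assoc, j_iota.
Qed.

(** * Comparison of the two families of notions *)

Let T := double_dual (Omega_j j).

(** Dense monomorphisms are stable under multiplication by [W], so the sheaf
    property of [Omega_j] yields its enriched form. *)
Lemma dense_mono_Sigma (D A : X) (d : Hom D A) : is_mono d -> j_dense j d -> Sigma T d.
Proof.
  intros Hd H. apply (j_dense_mono Hd) in H.
  apply Sigma_double_dual, pre_iso_iff. intros W g.
  destruct (Omega_j_extend (whisk_mono (W := W) Hd) g) as [u Hu].
  exists u. split; [exact Hu|]. intros v Hv.
  apply (dense_cancel_iota (whisk_dense (whisk_mono Hd) H)). now rewrite Hu.
Qed.

(** The element [b] factors through [m] iff the closed truth value classifying
    [m] is true at [b], and this can be tested after composition with W × e. *)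
Lemma closed_lift (A1 A2 B : X) (e : Hom A1 A2) (m : Sub B) (W : X)
    (a : Hom (bprod W A1) (sdom m)) (b : Hom (bprod W A2) B) :
  j_closed j m -> is_mono (pre e (Omega_j j)) ->
  sarr m ∘ a = b ∘ whisk W e -> exists u, u ∘ whisk W e = a /\ sarr m ∘ u = b.
Proof.
  intros Hm He E. apply j_closed_iff in Hm.
  destruct (iota_lift Hm) as [phi Hphi].
  destruct (iota_lift (j_truth (bprod W A2))) as [t Ht].
  assert (K : phi ∘ b = t).
  { apply curry_inj, He. rewrite !pre_curry. f_equal. apply iota_mono.
    rewrite comp_assoc, <- E, <- !comp_assoc, Hphi, Ht, chi_arr. now rewrite !truth_comp. }
  destruct (proj1 (chi_truth (smono m) b)) as [u Hu].
  { change (sub_chi m ∘ b = truth _). now rewrite <- Hphi, comp_assoc, K. }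
  exists u. split; [|exact Hu]. apply (smono m). now rewrite <- comp_assoc, Hu.
Qed.

Lemma closed_orth (A1 A2 B : X) (e : Hom A1 A2) (m : Sub B) :
  j_closed j m -> is_mono (pre e (Omega_j j)) -> orth e (sarr m).
Proof.
  intros Hm He. apply orth_iff. intros W a b E.
  destruct (closed_lift Hm He E) as [u [H1 H2]].
  exists u. split; [now split|]. intros v [_ Hv]. apply (smono m). now rewrite H2.
Qed.

Lemma closure_dense (A : X) (m : Sub A) (d : Hom (sdom m) (sdom (j_closure j m))) :
  sarr (j_closure j m) ∘ d = sarr m -> is_mono d /\ j_dense j d.
Proof.
  intros E. assert (Hd : is_mono d).
  { apply (mono_right_factor (g := sarr (j_closure j m))). rewrite E. apply smono. }
  split; [exact Hd|]. apply (j_dense_mono Hd).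
  apply (dense_in_closure Hd E). symmetry. apply chi_closure.
Qed.

(** If [m] is T-closed, lifting the identity against its dense inclusion in the
    closure shows that the inclusion is invertible. *)
Lemma T_closed_iff (A : X) (m : Sub A) : T_closed T (sarr m) <-> j_closed j m.
Proof.
  split.
  - intros [Hm _]. destruct (closure_factor m) as [d Hd].
    destruct (closure_dense Hd) as [Md Dd].
    pose proof (Hm _ _ d (dense_mono_Sigma Md Dd)) as O.
    destruct (orth_lift (a := idm _) (b := sarr (j_closure j m)) O) as [u [H1 H2]].
    { now rewrite comp_idr. }
    exists u. split; [|exact H2]. exists d. split; [|exact H1].
    apply (smono (j_closure j m)). now rewrite <- comp_assoc, Hd, H2, comp_idr.
  - intros H. split; [|apply smono]. intros A1 A2 h Hh. apply closed_orth; [exact H|].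
    apply iso_mono. exact (proj1 (Sigma_double_dual (Omega_j j) h) Hh).
Qed.

(** R-valued maps are determined along the epimorphism onto the image by
    definition, and along the inclusion of the image since it is dense. *)
Lemma j_dense_cancel (A B : X) (f : Hom A B) :
  j_dense j f -> is_mono (pre f (Omega_j j)).
Proof.
  intros [m [e [He [-> Ht]]]]. rewrite pre_comp. apply mono_comp.
  - intros W u v E. rewrite <- (curry_uncurry u), <- (curry_uncurry v), !pre_curry in E.
    apply curry_inj in E. apply (whisk_epi He) in E.
    now rewrite <- (curry_uncurry u), <- (curry_uncurry v), E.
  - apply iso_mono. refine (proj1 (Sigma_double_dual (Omega_j j) (sarr m)) (dense_mono_Sigma (smono m) _)).
    apply (j_dense_mono (smono m)). now apply closure_total.
Qed.

Lemma dense_closed_factorization (A B : X) (f : Hom A B) :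
  exists (c : Sub B) (e : Hom A (sdom c)), f = sarr c ∘ e /\ j_dense j e /\ j_closed j c.
Proof.
  destruct (image f) as [m [e [He ->]]]. destruct (closure_factor m) as [d Hd].
  exists (j_closure j m), (d ∘ e). split; [now rewrite <- comp_assoc, Hd|].
  split; [|apply closure_closed]. destruct (closure_dense Hd) as [Md Dd].
  exists (Build_Sub Md), e. split; [exact He|]. split; [reflexivity|].
  apply closure_total. now apply j_dense_mono.
Qed.

(** If [f] is T-dense, lifting the identity of [B] against the closure of the
    image of [f] gives a section of that closure. *)
Lemma T_dense_iff (A B : X) (f : Hom A B) : T_dense T f <-> j_dense j f.
Proof.
  split.
  - intros H. destruct (image f) as [m [e [He E]]]. destruct (closure_factor m) as [d Hd].
    pose proof (H _ _ _ (proj2 (T_closed_iff _) (closure_closed m))) as O.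
    destruct (orth_lift (a := d ∘ e) (b := idm B) O) as [u [_ Hu]].
    { now rewrite comp_idl, <- comp_assoc, Hd. }
    exists m, e. split; [exact He|]. split; [exact E|].
    exact (mono_retraction_iso (smono (j_closure j m)) Hu).
  - intros H B1 B2 m Hm.
    exact (closed_orth (proj1 (T_closed_iff (Build_Sub (proj2 Hm))) Hm) (j_dense_cancel H)).
Qed.

(** Both subobjects are second factors of dense-closed factorizations of [m], so
    orthogonality in each direction compares them. *)
Lemma T_closure_iff (A : X) (m c : Sub A) :
  is_T_closure T m c <-> sub_iso c (j_closure j m).
Proof.
  destruct (closure_factor m) as [d Hd]. destruct (closure_dense Hd) as [Md Dd].
  pose proof (closure_closed m) as Hc. split.
  - intros [e [E [He Hcc]]].
    pose proof (He _ _ _ (proj2 (T_closed_iff _) Hc)) as O1.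
    destruct (orth_lift (a := d) (b := sarr c) O1) as [u [_ Hu]].
    { now rewrite Hd, E. }
    pose proof (proj2 (T_dense_iff d) Dd _ _ _ Hcc) as O2.
    destruct (orth_lift (a := e) (b := sarr (j_closure j m)) O2) as [v [_ Hv]].
    { now rewrite Hd, E. }
    exists u. split; [|exact Hu]. exists v. split.
    + apply (smono c). now rewrite <- comp_assoc, Hv, Hu, comp_idr.
    + apply (smono (j_closure j m)). now rewrite <- comp_assoc, Hu, Hv, comp_idr.
  - intros [u [[v [vu uv]] Hu]].
    assert (Hv : sarr c ∘ v = sarr (j_closure j m)).
    { now rewrite <- Hu, comp_assoc, uv, comp_idr. }
    assert (Ed : sarr c ∘ (v ∘ d) = sarr m) by now rewrite <- comp_assoc, Hv.
    exists (v ∘ d). split; [easy|].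
    assert (Ec : sub_chi c = sub_chi (j_closure j m)).
    { apply sub_iso_iff. exists u. split; [now exists v|exact Hu]. }
    split.
    + apply T_dense_iff. assert (Mvd : is_mono (v ∘ d)).
      { apply (mono_right_factor (g := sarr c)). rewrite Ed. apply smono. }
      apply (j_dense_mono Mvd). apply (dense_in_closure Mvd Ed).
      now rewrite Ec, chi_closure.
    + apply T_closed_iff, j_closed_iff. now rewrite Ec, chi_closure, j_j.
Qed.

(** * Separated objects and sheaves *)

Lemma complete_sheaf (B : X) : T_complete T B -> j_sheaf j B.
Proof.
  intros H D A d Hd Dd g. pose proof (H _ _ d (dense_mono_Sigma Hd Dd)) as I.
  destruct (pre_iso_extend g I) as [u Hu]. exists u. split; [exact Hu|].
  intros v Hv. apply (pre_iso_unique I). now rewrite Hu.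
Qed.

Lemma sheaf_separated (B : X) : j_sheaf j B -> j_separated j B.
Proof.
  intros H D A d Hd Dd u v E. destruct (H D A d Hd Dd (v ∘ d)) as [w [_ Hw]].
  now rewrite <- (Hw u E), <- (Hw v eq_refl).
Qed.

Lemma subobject_separated (B Y : X) (m : Hom B Y) :
  is_mono m -> j_separated j Y -> j_separated j B.
Proof.
  intros Hm HY D A d Hd Dd u v E. apply Hm. apply (HY D A d Hd Dd).
  now rewrite !comp_assoc, E.
Qed.

Lemma bidual_separated (B : X) : j_separated j (exp (exp B (Omega_j j)) (Omega_j j)).
Proof. apply sheaf_separated, complete_sheaf, complete_double_dual. Qed.

(** Elements [u] and [v] that the unit identifies agree on every R-valued map,
    also one with parameters. Applied to the closure of the diagonal with first
    argument [u], this says that (u, v) lies in that closure, so the equalizer of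
    [u] and [v], which is the pullback of the diagonal, is dense. *)
Lemma separated_ev_mono (B : X) : j_separated j B <-> is_mono (dual_ev (Omega_j j) B).
Proof.
  split.
  - intros HB W u v E.
    assert (Hdelta : is_mono ⟨idm B, idm B⟩).
    { intros Z a b K. rewrite !pair_comp, !comp_idl in K.
      pose proof (f_equal (fun k => pi1 ∘ k) K) as K1. cbn in K1.
      now rewrite !pi1_pair in K1. }
    destruct (iota_lift (phi := j ∘ chi Hdelta)) as [q Hq]; [apply j_j|].
    assert (Q : q ∘ ⟨u, u⟩ = q ∘ ⟨u, v⟩).
    { unfold dual_ev in E. rewrite !curry_comp in E. apply curry_inj in E.
      (* Evaluate the common value at the predicate of being in the closure of
         the diagonal together with [u]. *)
      apply (f_equal (fun k => k ∘ ⟨idm W, curry q ∘ u⟩)) in E.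
      autorewrite with ccc in E. exact E. }
    apply (f_equal (fun k => iota ∘ k)) in Q.
    rewrite <- !comp_assoc, Hq, !comp_assoc in Q.
    apply (HB _ _ (equ_arr u v)); [apply equ_mono| |apply equ_eq].
    apply (j_dense_mono (@equ_mono _ _ _ u v)).
    assert (K : chi (@equ_mono _ _ _ u v) = chi Hdelta ∘ ⟨u, v⟩).
    { apply omega_ext. intros Z w. rewrite comp_assoc, !chi_truth. split; intros [w' H].
      - exists (u ∘ w). rewrite <- H, !pair_comp, !comp_idl. f_equal.
        now rewrite <- !comp_assoc, equ_eq.
      - rewrite !pair_comp, !comp_idl in H.
        pose proof (f_equal (fun k => pi1 ∘ k) H) as H1.
        pose proof (f_equal (fun k => pi2 ∘ k) H) as H2. cbn in H1, H2.
        rewrite !pi1_pair in H1. rewrite !pi2_pair in H2.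
        destruct (@equ_univ X _ _ u v Z w) as [z [Hz _]]; [congruence|now exists z]. }
    rewrite K, <- Q.
    assert (Ku : chi Hdelta ∘ ⟨u, u⟩ = truth W).
    { apply chi_truth. exists u. now rewrite pair_comp, comp_idl. }
    rewrite Ku. apply j_truth.
  - intros H. exact (subobject_separated H (@bidual_separated B)).
Qed.

(** The sheaf property retracts the closure of [B] in its bidual onto [B]; the
    closure is separated, so the retraction inverts the dense inclusion and [B] is
    closed in its bidual. *)
Lemma sheaf_complete (B : X) : j_sheaf j B -> T_complete T B.
Proof.
  intros HB. pose proof (proj1 (separated_ev_mono B) (sheaf_separated HB)) as Hm.
  pose (m := Build_Sub Hm).
  apply (closed_complete (Y := exp (exp B (Omega_j j)) (Omega_j j)) (m := sarr m));
    [|apply complete_double_dual].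
  apply T_closed_iff. destruct (closure_factor m) as [d Hd].
  destruct (closure_dense Hd) as [Md Dd].
  assert (R : exists r : Hom (sdom (j_closure j m)) (sdom m), r ∘ d = idm (sdom m)).
  { destruct (HB _ _ d Md Dd (idm B)) as [r [Hr _]]. now exists r. }
  destruct R as [r Hr].
  assert (Hs : j_separated j (sdom (j_closure j m))).
  { apply (subobject_separated (smono (j_closure j m))). apply bidual_separated. }
  assert (Hdr : d ∘ r = idm _).
  { apply (Hs _ _ d Md Dd). now rewrite comp_assoc, Hr, comp_idl, comp_idr. }
  exists r. split; [now exists d|]. now rewrite <- Hd, comp_assoc, Hdr, comp_idr.
Qed.

(** The reflection is the closure of the image of the unit at [A]. *)
Lemma reflection_exists (A : X) :
  exists (B : X) (r : Hom A B), Sigma T r /\ T_complete T B.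
Proof.
  destruct (dense_closed_factorization (dual_ev (Omega_j j) A)) as [c [e [E [He Hc]]]].
  exists (sdom c), e. split.
  - apply (Sigma_of_unit_factor (c := sarr c)); [easy|]. now apply j_dense_cancel.
  - apply (closed_complete (proj2 (T_closed_iff c) Hc)). apply complete_double_dual.
Qed.

End Topology.

Theorem theorem8p8 (X : Topos) (j : LawvereTierney X) :
  let T : XMonad (self X) := double_dual (Omega_j j) in
  (forall (A B : X) (f : Hom A B), T_dense T f <-> j_dense j f) /\
  (forall (A : X) (m : Sub A), T_closed T (sarr m) <-> j_closed j m) /\
  (forall (A B : X) (f : Hom A B), exists (C : X) (e : Hom A C) (m : Hom C B),
     f = m ∘ e /\ T_dense T e /\ T_closed T m) /\
  (forall (A : X) (m c : Sub A), is_T_closure T m c <-> sub_iso c (j_closure j m)) /\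
  (forall B : X, T_complete T B <-> j_sheaf j B) /\
  (forall B : X, T_separated T B <-> j_separated j B) /\
  ((exists S : XMonad (self X), idempotent_core T S) /\
   (forall (S : XMonad (self X)) (HS : idempotent_core T S) (B : X),
      robj (reflective_of_idempotent (core_idempotent HS)) B <-> j_sheaf j B)).
Proof.
  intros T.
  assert (Hcomplete : forall B : X, T_complete T B <-> j_sheaf j B).
  { intros B. split; [apply complete_sheaf|apply sheaf_complete]. }
  split; [apply T_dense_iff|]. split; [apply T_closed_iff|]. split.
  { intros A B f. destruct (dense_closed_factorization j f) as [c [e [E [He Hc]]]].
    exists (sdom c), e, (sarr c). split; [exact E|]. split.
    - now apply T_dense_iff.
    - now apply T_closed_iff. }
  split; [apply T_closure_iff|]. split; [exact Hcomplete|]. split.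
  { intros B. unfold T_separated.
    rewrite (separated_ev_mono j B).
    pose proof (ueta_double_dual (Omega_j j) B) as E.
    exact (eq_ind_r (fun t : Hom B (exp (exp B (Omega_j j)) (Omega_j j)) =>
      is_mono t <-> is_mono (dual_ev (Omega_j j) B)) (iff_refl _) E). }
  split.
  - apply core_exists. apply reflection_exists.
  - intros S HS B. rewrite <- Hcomplete. exact (core_fixed HS B).
Qed.
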